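(* Let $D_n^{\ast}$, $C_B[0,\infty)$, $\omega_2$ and $\lambda_n(x)$ be as defined in the context. There is a constant $M>0$, independent of $f$, $n$ and $x$, such that for any $f\in C_B[0,\infty)$, every $n\in\mathbb{N}$ and every $x\in[0,\infty)$, $$\left|D_n^{\ast}(f;x)-f(x)\right|\le 2M\left\{\min\left(1,\frac{\lambda_n(x)}{2}\right)\|f\|_{C_B}+\omega_2\!\left(f;\sqrt{\frac{\lambda_n(x)}{2}}\right)\right\}.$$
   Context: Fix real numbers $\mu\ge 0$ and $\lambda\ge 0$. For $k\in\mathbb{N}_0$ put $\theta_k=0$ if $k$ is even and $\theta_k=1$ if $k$ is odd. The coefficients $\gamma_\mu$ are $$\gamma_\mu(2k)=\frac{2^{2k}k!\,\Gamma(k+\mu+\frac12)}{\Gamma(\mu+\frac12)},\qquad \gamma_\mu(2k+1)=\frac{2^{2k+1}k!\,\Gamma(k+\mu+\frac32)}{\Gamma(\mu+\frac12)},\quad k\in\mathbb{N}_0,$$ and they satisfy $\gamma_\mu(k+1)=(k+1+2\mu\theta_{k+1})\gamma_\mu(k)$. The Dunkl exponential is $e_\mu(x)=\sum_{k=0}^\infty \frac{x^k}{\gamma_\mu(k)}$. Let $(a_r)_{r\ge0}$ be real numbers with $a_0\neq0$ such that $A(t)=\sum_{r=0}^\infty\frac{a_r}{\gamma_\mu(r)}t^r$ is analytic in a disc $|t|<R$ with $R>1$; assume $A(1)\ne0$ and $\frac{a_r}{A(1)}\ge0$ for all $r\ge0$. The Dunkl–Appell polynomials $p_k$ are $$p_k(x)=\sum_{m=0}^k\frac{\gamma_\mu(k)}{\gamma_\mu(m)\gamma_\mu(k-m)}a_{k-m}x^m,$$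 equivalently $A(t)e_\mu(xt)=\sum_{k=0}^\infty\frac{p_k(x)}{\gamma_\mu(k)}t^k$. For $n\in\mathbb{N}=\{1,2,\dots\}$, $x\in[0,\infty)$ and $f\in C[0,\infty)$ (for which the expression is defined), $$D_n^{\ast}(f;x)=\frac{1}{e_\mu(nx)A(1)}\sum_{k=0}^\infty\frac{p_k(nx)}{\gamma_\mu(k)}\frac{n^{k+2\mu\theta_k+\lambda+1}}{\Gamma(k+2\mu\theta_k+\lambda+1)}\int_0^\infty e^{-nt}t^{k+2\mu\theta_k+\lambda}f(t)\,dt.$$ Put $\Omega_n^1(x):=D_n^{\ast}(t-x;x)$ and $\Omega_n^2(x):=D_n^{\ast}((t-x)^2;x)$, i.e. $D_n^{\ast}$ applied to the functions $t\mapsto t-x$ and $t\mapsto(t-x)^2$ and evaluated at $x$ (superscripts are indices, not powers), and $$\lambda_n(x):=\Omega_n^1(x)+\frac{\Omega_n^2(x)}{2}.$$ $C_B[0,\infty)$ is the space of bounded, uniformly continuous real-valued functions on $[0,\infty)$ with norm $\|f\|_{C_B}=\sup_{x\in[0,\infty)}|f(x)|$. For $f\in C_B[0,\infty)$ and $\delta>0$, the second modulus of continuity is $\omega_2(f;\delta):=\sup_{0<t\le\delta}\|f(\cdot+2t)-2f(\cdot+t)+f(\cdot)\|_{C_B}$. *)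

(* Defs.v *)
(* Stdlib real numbers with Coquelicot. *)
From Stdlib Require Export Arith Reals.
From Coquelicot Require Export Coquelicot.
Open Scope R_scope.

(* [Rpower t s] is exp (s * ln t), so it is the usual power only for t > 0;
   the filter [at_right 0] keeps the integrals below inside that region. *)
Definition Gamma (s : R) : R :=
  RInt_gen (fun t => Rpower t (s - 1) * exp (- t))
           (at_right 0) (Rbar_locally p_infty).

Definition theta (k : nat) : R := if Nat.even k then 0 else 1.

(* With j := k / 2, the two branches are the values at k = 2j and k = 2j+1. *)
Definition gamma (mu : R) (k : nat) : R :=
  let j := Nat.div2 k in
  if Nat.even k
  then 2 ^ (2 * j) * INR (fact j) * Gamma (INR j + mu + 1 / 2)
       / Gamma (mu + 1 / 2)
  else 2 ^ (2 * j + 1) * INR (fact j) * Gamma (INR j + mu + 3 / 2)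
       / Gamma (mu + 1 / 2).

Definition dunkl_exp (mu x : R) : R := PSeries (fun k => / gamma mu k) x.

Definition A_coef (mu : R) (a : nat -> R) (r : nat) : R := a r / gamma mu r.

Definition A_fun (mu : R) (a : nat -> R) (t : R) : R :=
  PSeries (A_coef mu a) t.

Definition dunkl_appell (mu : R) (a : nat -> R) (k : nat) (x : R) : R :=
  sum_f_R0
    (fun m => gamma mu k / (gamma mu m * gamma mu (k - m)%nat)
              * a (k - m)%nat * x ^ m) k.

Definition Dstar (mu lam : R) (a : nat -> R) (n : nat) (f : R -> R) (x : R)
  : R :=
  / (dunkl_exp mu (INR n * x) * A_fun mu a 1) *
  Series (fun k =>
    dunkl_appell mu a k (INR n * x) / gamma mu k
    * (Rpower (INR n) (INR k + 2 * mu * theta k + lam + 1)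
       / Gamma (INR k + 2 * mu * theta k + lam + 1))
    * RInt_gen
        (fun t => exp (- INR n * t)
                  * Rpower t (INR k + 2 * mu * theta k + lam) * f t)
        (at_right 0) (Rbar_locally p_infty)).

Definition Omega1 (mu lam : R) (a : nat -> R) (n : nat) (x : R) : R :=
  Dstar mu lam a n (fun t => t - x) x.

Definition Omega2 (mu lam : R) (a : nat -> R) (n : nat) (x : R) : R :=
  Dstar mu lam a n (fun t => (t - x) ^ 2) x.

Definition lambda_n (mu lam : R) (a : nat -> R) (n : nat) (x : R) : R :=
  Omega1 mu lam a n x + Omega2 mu lam a n x / 2.

(* A function on [0, oo) is represented by a function on R whose values on
   the negative half-line are never consulted. *)
Definition C_B (f : R -> R) : Prop :=
  (exists B, forall x, 0 <= x -> Rabs (f x) <= B) /\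
  uniform_continuity f (fun x => 0 <= x).

(* [real] sends an infinite supremum to 0; for f in C_B and d > 0 the suprema
   in [norm_CB] and [omega2] are finite. *)
Definition norm_CB (f : R -> R) : R :=
  real (Lub_Rbar (fun y => exists x, 0 <= x /\ y = Rabs (f x))).

Definition omega2 (f : R -> R) (d : R) : R :=
  real (Lub_Rbar (fun y => exists t, 0 < t <= d /\
    y = norm_CB (fun x => f (x + 2 * t) - 2 * f (x + t) + f x))).

(* Main.v *)
From Stdlib Require Import Lra Lia Psatz.
Require Import Defs.

(** The value at [x] of the operator is an expectation: [Dstar f x] averages [f]
    over a mixture of gamma densities, the [k]-th density being proportional to
    [exp (- n t) * t ^ (k + 2 mu theta_k + lam)] and carrying the weight
    [P_k = p_k (n x) / (gamma_k * e_mu (n x) * A 1)].  The weights are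
    nonnegative because the [a_r / A 1] are, and they sum to [1] by the generating
    identity [A t * e_mu (y t) = sum p_k(y) / gamma_k t^k] at [t = 1]
    ([appell_weight_series]).  Hence, if [f t] differs from an affine function
    [F + G (t - x)] by at most [K + L (t - x)^2] for all [t > 0], then [Dstar f x]
    differs from [F + G Omega1] by at most [K + L Omega2]
    ([Dstar_affine_defect]).

    For [d = lambda_n / 2 < 1] the affine function comes from a Steklov mean [g]
    of [f] with step [sqrt d / 2] ([steklov_smoothing]): with
    [W = omega2 f (sqrt d)] it satisfies [|f - g| <= W] and [|g''| <= L = 9 W / d],
    and [g'] is then controlled by [|f|], [W] and [L] through a Landau inequality
    ([landau_half_line]).  Taking [F = f x], [G = g' x] and [K = 2 W] bounds the
    error by [2 W + L Omega2 + |g' x| Omega1], where [Omega1] and [Omega2] are at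
    most [2 d] and [4 d].  For [d >= 1] the crude bound [2 |f|] suffices, since
    then [Rmin 1 d = 1].

    This needs [lambda_n > 0], and [Omega1 >= 0] so that [Omega1 <= lambda_n].
    The delicate point is the sign of [Omega1] ([Omega1_pos]).  The [k]-th density has
    mean [(k + 2 mu theta_k + lam + 1) / n], so it is enough that the mean of
    [k + 2 mu theta_k] under the weights is at least [n x]
    ([appell_weight_mean]).  Now [k = m + r], with [m] distributed as the terms of
    [e_mu (n x)], for which the mean of [m + 2 mu theta_m] is exactly [n x], and
    [r] distributed as the terms of [A 1].  An odd [r] flips the parity of [m], which may lower
    [k + 2 mu theta_k]; on average it does not, because
    [e_mu y + 2 mu e_mu (- y) >= 0] ([parity_gap_series_nonneg]). *)

(** * Improper integrals over the positive half-line *)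

Notation is_RInt_pos f l := (is_RInt_gen f (at_right 0) (Rbar_locally p_infty) l).
Notation ex_RInt_pos f := (ex_RInt_gen f (at_right 0) (Rbar_locally p_infty)).

(** Equalities between values of [RInt] are typed in a normed module whose
    carrier is only convertible to [R]; restating them in [R] makes them visible to
    linear arithmetic. *)
Ltac Rlin := match goal with |- @eq _ ?u ?v => change (@eq R u v) end; lra.

Lemma filter_prod_pos (P : R * R -> Prop) :
  (forall u v, 0 < u -> u <= v -> P (u, v)) ->
  filter_prod (at_right 0) (Rbar_locally p_infty) P.
Proof.
  intros HP.
  apply (Filter_prod _ _ _ (fun u => 0 < u <= 1) (fun v => 1 < v)).
  - exists (mkposreal 1 Rlt_0_1). intros u Hu Hu0. simpl in Hu.
    unfold ball in Hu; simpl in Hu. unfold AbsRing_ball, abs, minus, plus, opp in Hu; simpl in Hu.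
    apply Rabs_def2 in Hu. lra.
  - exists 1. auto.
  - intros u v [Hu Hu1] Hv. apply HP; lra.
Qed.

Lemma ex_RInt_pos_segment (f : R -> R) u v :
  (forall t, 0 < t -> continuous f t) -> 0 < u -> 0 < v -> ex_RInt f u v.
Proof.
  intros Hf Hu Hv. apply (ex_RInt_continuous (V := R_CompleteNormedModule)).
  intros z [Hz _]. apply Hf. apply Rlt_le_trans with (2 := Hz). now apply Rmin_glb_lt.
Qed.

(** Cauchy's criterion for [f] follows from the one for [g]: moving a single end
    point of the segment changes the integral of [f] by no more than that of [g]. *)
Lemma ex_RInt_pos_dominated (f g : R -> R) :
  (forall t, 0 < t -> continuous f t) -> (forall t, 0 < t -> continuous g t) ->
  (forall t, 0 < t -> Rabs (f t) <= g t) -> ex_RInt_pos g -> ex_RInt_pos f.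
Proof.
  intros Cf Cg Hfg Hg.
  assert (Habs : forall u v, 0 < u -> 0 < v -> Rabs (RInt f u v) <= Rabs (RInt g u v)).
  { assert (H0 : forall u v, 0 < u -> u <= v -> Rabs (RInt f u v) <= Rabs (RInt g u v)).
    { intros u v Hu Huv. apply Rle_trans with (2 := Rle_abs _).
      assert (Ef := RInt_correct _ _ _ (ex_RInt_pos_segment f u v Cf Hu (Rlt_le_trans _ _ _ Hu Huv))).
      assert (Eg := RInt_correct _ _ _ (ex_RInt_pos_segment g u v Cg Hu (Rlt_le_trans _ _ _ Hu Huv))).
      apply (norm_RInt_le (V := R_NormedModule) f g u v _ _ Huv); auto.
      intros t [Ht _]. apply Hfg. lra. }
    intros u v Hu Hv. destruct (Rle_dec u v) as [H|H]; [now apply H0|].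
    rewrite <- (opp_RInt_swap f), <- (opp_RInt_swap g); try now apply ex_RInt_pos_segment.
    unfold opp; simpl. rewrite !Rabs_Ropp. apply H0; lra. }
  destruct Hg as [L HL].
  assert (U : forall (k : R -> R), (forall t, 0 < t -> continuous k t) ->
    filter_prod (at_right 0) (Rbar_locally p_infty) (fun x : R * R =>
      (exists y, is_RInt k (fst x) (snd x) y) /\
      (forall y1 y2, is_RInt k (fst x) (snd x) y1 -> is_RInt k (fst x) (snd x) y2 -> y1 = y2))).
  { intros k Ck. apply filter_prod_pos. intros u v Hu Huv. simpl. split.
    - apply ex_RInt_pos_segment; auto; lra.
    - intros y1 y2 H1 H2. rewrite <- (is_RInt_unique _ _ _ _ H1). now apply is_RInt_unique. }
  destruct (filterlimi_locally_cauchy (U := R_CompleteNormedModule)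
     (F := filter_prod (at_right 0) (Rbar_locally p_infty))
     (fun ab y => is_RInt g (fst ab) (snd ab) y) (U g Cg)) as [_ Hcg].
  destruct (filterlimi_locally_cauchy (U := R_CompleteNormedModule)
     (F := filter_prod (at_right 0) (Rbar_locally p_infty))
     (fun ab y => is_RInt f (fst ab) (snd ab) y) (U f Cf)) as [Hcf _].
  apply Hcf. intros eps.
  destruct (Hcg (ex_intro _ L HL) (pos_div_2 eps)) as [P [HP HPe]].
  destruct HP as [Q1 Q2 HQ1 HQ2 HQ].
  exists (fun ab => (Q1 (fst ab) /\ 0 < fst ab) /\ (Q2 (snd ab) /\ 0 < snd ab)). split.
  - apply (Filter_prod _ _ _ (fun u => Q1 u /\ 0 < u) (fun v => Q2 v /\ 0 < v)).
    + apply filter_and; auto. exists (mkposreal 1 Rlt_0_1). auto.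
    + apply filter_and; auto. exists 0. auto.
    + simpl. tauto.
  - intros [u1 v1] [u2 v2]; simpl. intros [[A1 A2] [A3 A4]] [[B1 B2] [B3 B4]] y1 y2 Y1 Y2.
    rewrite <- (is_RInt_unique _ _ _ _ Y1), <- (is_RInt_unique _ _ _ _ Y2).
    assert (E : forall k, (forall t, 0 < t -> continuous k t) -> forall p q r, 0 < p -> 0 < q -> 0 < r ->
       RInt k p q + RInt k q r = RInt k p r).
    { intros k Ck p q r Hp Hq Hr. apply (RInt_Chasles k p q r); now apply ex_RInt_pos_segment. }
    assert (G : forall p q r s, Q1 p -> 0 < p -> Q2 q -> 0 < q -> Q1 r -> 0 < r -> Q2 s -> 0 < s ->
       Rabs (RInt g r s - RInt g p q) < eps / 2).
    { intros p q r s ? ? ? ? ? ? ? ?.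
      apply (HPe (p, q) (r, s)); simpl; auto.
      - apply (RInt_correct g), ex_RInt_pos_segment; auto.
      - apply (RInt_correct g), ex_RInt_pos_segment; auto. }
    change (Rabs (RInt f u2 v2 - RInt f u1 v1) < eps).
    replace (RInt f u2 v2 - RInt f u1 v1) with (RInt f u2 u1 + RInt f v1 v2).
    2:{ rewrite <- (E f Cf u2 u1 v2), <- (E f Cf u1 v1 v2); auto; Rlin. }
    apply Rle_lt_trans with (1 := Rabs_triang _ _).
    assert (K1 := Habs u2 u1 B2 A2). assert (K2 := Habs v1 v2 A4 B4).
    assert (G1 := G u1 v1 u2 v1 A1 A2 A3 A4 B1 B2 A3 A4).
    assert (G2 := G u1 v1 u1 v2 A1 A2 A3 A4 A1 A2 B3 B4).
    replace (RInt g u2 v1 - RInt g u1 v1) with (RInt g u2 u1) in G1.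
    2:{ rewrite <- (E g Cg u2 u1 v1); auto; Rlin. }
    replace (RInt g u1 v2 - RInt g u1 v1) with (RInt g v1 v2) in G2.
    2:{ rewrite <- (E g Cg u1 v1 v2); auto; Rlin. }
    lra.
Qed.

(** The difference [g - f] equals its own norm on the half-line, so its integral
    bounds its own norm. *)
Lemma is_RInt_pos_le (f g : R -> R) lf lg :
  (forall t, 0 < t -> f t <= g t) -> is_RInt_pos f lf -> is_RInt_pos g lg -> lf <= lg.
Proof.
  intros Hfg Hf Hg.
  assert (H := is_RInt_gen_minus _ _ _ _ Hg Hf).
  assert (H1 : norm (minus lg lf) <= minus lg lf).
  { apply (fun A B => RInt_gen_norm _ _ (minus lg lf) (minus lg lf) A B H H).
    - apply filter_prod_pos. auto.
    - apply filter_prod_pos. simpl. intros u v Hu _ t [Ht _].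
      unfold norm, minus, plus, opp; simpl. unfold abs; simpl.
      rewrite Rabs_pos_eq; [lra|]. specialize (Hfg t ltac:(lra)). lra. }
  unfold norm, minus, plus, opp in H1; simpl in H1. unfold abs in H1; simpl in H1.
  assert (H2 := Rabs_pos (lg + - lf)). lra.
Qed.

Lemma is_RInt_pos_ext (f g : R -> R) l :
  (forall t, 0 < t -> f t = g t) -> is_RInt_pos f l -> is_RInt_pos g l.
Proof.
  intros Hfg. apply is_RInt_gen_ext. apply filter_prod_pos. simpl.
  intros u v Hu Huv t [Ht _]. apply Hfg. rewrite Rmin_left in Ht; lra.
Qed.

Lemma is_RInt_pos_unique (f : R -> R) l :
  is_RInt_pos f l -> RInt_gen f (at_right 0) (Rbar_locally p_infty) = l.
Proof. apply (is_RInt_gen_unique (V := R_CompleteNormedModule)). Qed.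

Lemma is_RInt_pos_derive (F f : R -> R) la lb :
  (forall t, 0 < t -> is_derive F t (f t)) -> (forall t, 0 < t -> continuous f t) ->
  filterlim F (at_right 0) (locally la) -> filterlim F (Rbar_locally p_infty) (locally lb) ->
  is_RInt_pos f (lb - la).
Proof.
  intros HF Cf Ha Hb. apply is_RInt_pos_ext with (Derive F).
  - intros t Ht. now apply is_derive_unique, HF.
  - apply is_RInt_gen_Derive; auto; apply filter_prod_pos; simpl; intros u v Hu Huv t [Ht _];
      rewrite Rmin_left in Ht by lra; assert (Ht0 : 0 < t) by lra.
    + exists (f t). auto.
    + apply continuous_ext_loc with f; [|auto].
      exists (mkposreal t Ht0). intros z Hz. symmetry. apply is_derive_unique, HF.
      apply Rabs_def2 in Hz. unfold minus, plus, opp in Hz; simpl in Hz. lra.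
Qed.

Lemma is_RInt_pos_scale (f : R -> R) c l :
  0 < c -> is_RInt_pos f l -> is_RInt_pos (fun t => f (c * t)) (l / c).
Proof.
  intros Hc Hf.
  apply is_RInt_pos_ext with (fun t => scal (/ c) (scal c (f (c * t + 0)))).
  { intros t Ht. unfold scal; simpl; unfold mult; simpl. rewrite Rplus_0_r. field. lra. }
  replace (l / c) with (scal (/ c) l) by (unfold scal; simpl; unfold mult; simpl; field; lra).
  apply (is_RInt_gen_scal (V := R_NormedModule)).
  intros P HP. destruct (Hf P HP) as [Q1 Q2 HQ1 HQ2 HQ].
  apply (Filter_prod _ _ _ (fun u => Q1 (c * u)) (fun v => Q2 (c * v))).
  - destruct HQ1 as [e He]. assert (Hec : 0 < e / c) by (apply Rdiv_lt_0_compat; [apply e | auto]).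
    exists (mkposreal _ Hec). intros u Hu Hu0. apply He; [|nra].
    change (Rabs (c * u - 0) < e). change (Rabs (u - 0) < e / c) in Hu.
    rewrite Rminus_0_r in *. rewrite Rabs_mult, (Rabs_pos_eq c) by lra.
    replace (pos e) with (c * (e / c)) by (field; lra). now apply Rmult_lt_compat_l.
  - destruct HQ2 as [B HB]. exists (B / c). intros v Hv. apply HB.
    replace B with (c * (B / c)) by (field; lra). now apply Rmult_lt_compat_l.
  - simpl. intros u v Hu Hv. destruct (HQ _ _ Hu Hv) as [y [Hy HPy]]. exists y. split; auto.
    simpl in Hy. apply (is_RInt_comp_lin (V := R_NormedModule) f c 0 u v).
    now rewrite !Rplus_0_r.
Qed.

(** * The Gamma function *)

Lemma near_0_pos (P : R -> Prop) d : 0 < d -> (forall t, 0 < t < d -> P t) -> at_right 0 P.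
Proof.
  intros Hd HP. exists (mkposreal d Hd). intros t Ht Ht0. apply HP.
  change (Rabs (t - 0) < d) in Ht. apply Rabs_def2 in Ht. lra.
Qed.

(** The constant is the maximum of the left side: [ln z <= z - 1] at
    [z = (1 + t) / p], where equality holds when [1 + t = p]. *)
Lemma Rpower_exp_bounded p t :
  0 < p -> 0 < t -> Rpower (1 + t) p * exp (- t) <= exp (1 - p + p * ln p).
Proof.
  intros Hp Ht. unfold Rpower. rewrite <- exp_plus.
  assert (H : ln ((1 + t) / p) <= (1 + t) / p - 1).
  { rewrite <- (ln_exp ((1 + t) / p - 1)).
    assert (0 < (1 + t) / p) by (apply Rdiv_lt_0_compat; lra).
    apply ln_le; auto. generalize (exp_ineq1_le ((1 + t) / p - 1)). lra. }
  rewrite ln_div in H by lra.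
  apply (Rmult_le_compat_l p) in H; [|lra].
  replace (p * ((1 + t) / p - 1)) with (1 + t - p) in H by (field; lra).
  destruct (Rle_lt_or_eq_dec (p * ln (1 + t) + - t) (1 - p + p * ln p)) as [h|h]; [nra| |].
  - now apply Rlt_le, exp_increasing.
  - rewrite h. lra.
Qed.

Lemma Rpower_lim_0 s : 0 < s -> filterlim (fun t => Rpower t s) (at_right 0) (locally 0).
Proof.
  intros Hs. apply filterlim_locally. intros eps.
  apply (near_0_pos _ (exp (ln eps / s)) (exp_pos _)). intros t [Ht0 Ht].
  change (Rabs (Rpower t s - 0) < eps). unfold Rpower.
  rewrite Rminus_0_r, Rabs_pos_eq by apply Rlt_le, exp_pos.
  rewrite <- (exp_ln eps) by apply eps. apply exp_increasing.
  apply ln_increasing in Ht; auto. rewrite ln_exp in Ht.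
  apply (Rmult_lt_compat_l s) in Ht; auto.
  now replace (ln eps) with (s * (ln eps / s)) by (field; lra).
Qed.

Lemma Rpower_exp_lim_p_infty s :
  0 < s -> filterlim (fun t => Rpower t s * exp (- t)) (Rbar_locally p_infty) (locally 0).
Proof.
  intros Hs. apply filterlim_locally. intros eps.
  set (C := exp (1 - (s + 1) + (s + 1) * ln (s + 1))).
  assert (HC : 0 < C) by apply exp_pos.
  assert (He := cond_pos eps).
  exists (C / eps). intros t Ht.
  assert (0 < C / eps) by now apply Rdiv_lt_0_compat.
  change (Rabs (Rpower t s * exp (- t) - 0) < eps).
  rewrite Rminus_0_r, Rabs_pos_eq.
  2:{ apply Rmult_le_pos; apply Rlt_le, exp_pos. }
  assert (H1 := Rpower_exp_bounded (s + 1) t ltac:(lra) ltac:(lra)). fold C in H1.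
  rewrite Rpower_plus, Rpower_1 in H1 by lra.
  assert (H2 : Rpower t s <= Rpower (1 + t) s) by (apply Rle_Rpower_l; lra).
  assert (H3 := exp_pos (- t)).
  assert (H4 : Rpower t s * exp (- t) <= Rpower (1 + t) s * exp (- t)) by nra.
  assert (C < eps * t).
  { replace C with (eps * (C / eps)) by (field; lra). now apply Rmult_lt_compat_l. }
  assert (0 < Rpower t s * exp (- t)) by (apply Rmult_lt_0_compat; auto; apply exp_pos).
  nra.
Qed.

Definition gamma_kernel (s t : R) : R := Rpower t (s - 1) * exp (- t).

Lemma gamma_kernel_continuous s t : 0 < t -> continuous (gamma_kernel s) t.
Proof.
  intros Ht. apply (ex_derive_continuous (V := R_NormedModule)).
  unfold gamma_kernel, Rpower. auto_derive. exact Ht.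
Qed.

(** The bound [(1 + t)^(s+1) * exp (- t) <= C] puts the kernel below
    [C * t^(s-1) / (1 + t)^(s+1)], which has the explicit primitive
    [C / s * (t / (1 + t))^s], with finite limits at both ends. *)
Lemma gamma_kernel_integrable s : 0 < s -> ex_RInt_pos (gamma_kernel s).
Proof.
  intros Hs.
  set (C := exp (1 - (s + 1) + (s + 1) * ln (s + 1))).
  set (F := fun t => C * (Rpower (t / (1 + t)) s / s)).
  set (f := fun t => C * (Rpower t (s - 1) / Rpower (1 + t) (s + 1))).
  assert (Cf : forall t, 0 < t -> continuous f t).
  { intros t Ht. apply (ex_derive_continuous (V := R_NormedModule)).
    unfold f, Rpower. auto_derive. repeat split; try lra. apply Rgt_not_eq, exp_pos. }
  apply ex_RInt_pos_dominated with f; auto.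
  - intros t Ht. now apply gamma_kernel_continuous.
  - intros t Ht. unfold gamma_kernel, f.
    assert (0 < Rpower t (s - 1)) by apply exp_pos.
    assert (0 < exp (- t)) by apply exp_pos.
    assert (HP : 0 < Rpower (1 + t) (s + 1)) by apply exp_pos.
    rewrite Rabs_pos_eq by nra.
    assert (H1 := Rpower_exp_bounded (s + 1) t ltac:(lra) ltac:(lra)). fold C in H1.
    replace (C * (Rpower t (s - 1) / Rpower (1 + t) (s + 1)))
      with (Rpower t (s - 1) * (C / Rpower (1 + t) (s + 1))) by (field; lra).
    apply Rmult_le_compat_l; [lra|]. apply Rle_div_r; auto. lra.
  - exists (C * (Rpower 1 s / s) - C * (0 / s)).
    apply is_RInt_pos_derive with F; auto.
    + intros t Ht. unfold F, f, Rpower.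
      assert (0 < t / (1 + t)) by (apply Rdiv_lt_0_compat; lra).
      auto_derive; [repeat split; lra|].
      change (t * / (1 + t)) with (t / (1 + t)). rewrite ln_div by lra.
      replace ((s - 1) * ln t) with (s * (ln t - ln (1 + t)) + s * ln (1 + t) + - ln t) by ring.
      replace ((s + 1) * ln (1 + t)) with (s * ln (1 + t) + ln (1 + t)) by ring.
      rewrite !exp_plus, exp_Ropp, !exp_ln by lra.
      assert (0 < exp (s * ln (1 + t))) by apply exp_pos.
      clearbody C. generalize dependent (exp (s * ln (1 + t))).
      generalize (exp (s * (ln t - ln (1 + t)))).
      intros E1 E2 HE2.
      replace ((1 * / (1 + t) + t * (- (1) * / ((1 + t) * (1 + t)))) * / (t / (1 + t)))
        with (/ t * / (1 + t)) by (field; lra).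
      field. repeat split; lra.
    + unfold F. clearbody C.
      apply (filterlim_comp _ _ _ (fun t => t / (1 + t)) (fun u => C * (Rpower u s / s)) _ (at_right 0)).
      * intros P [e He]. apply (near_0_pos _ e); [apply e|]. intros t [Ht0 Ht].
        assert (Hq : 0 < t / (1 + t)) by (apply Rdiv_lt_0_compat; lra).
        apply He; auto. change (Rabs (t / (1 + t) - 0) < e).
        rewrite Rminus_0_r, Rabs_pos_eq by lra.
        apply Rlt_div_l; nra.
      * apply (filterlim_comp _ _ _ (fun u => Rpower u s) (fun v => C * (v / s)) _ (locally 0)).
        now apply Rpower_lim_0.
        apply (ex_derive_continuous (V := R_NormedModule) (fun v => C * (v / s)) 0). auto_derive. auto.
    + unfold F. clearbody C.
      apply (filterlim_comp _ _ _ (fun t => t / (1 + t)) (fun u => C * (Rpower u s / s)) _ (locally 1)).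
      * apply filterlim_locally. intros e. exists (/ e). intros t Ht.
        assert (He := cond_pos e). assert (0 < / e) by now apply Rinv_0_lt_compat.
        change (Rabs (t / (1 + t) - 1) < e).
        replace (t / (1 + t) - 1) with (- (1 / (1 + t))) by (field; lra).
        rewrite Rabs_Ropp, Rabs_pos_eq.
        2:{ apply Rlt_le, Rdiv_lt_0_compat; lra. }
        apply Rlt_div_l; [lra|].
        assert (e * / e < e * t) by now apply Rmult_lt_compat_l.
        rewrite Rinv_r in H0 by lra. lra.
      * apply (ex_derive_continuous (V := R_NormedModule) (fun u => C * (Rpower u s / s)) 1).
        unfold Rpower. auto_derive. repeat split; lra.
Qed.

Lemma Gamma_correct s : 0 < s -> is_RInt_pos (gamma_kernel s) (Gamma s).
Proof.
  intros Hs. apply (RInt_gen_correct (V := R_CompleteNormedModule)).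
  now apply gamma_kernel_integrable.
Qed.

(** Integration by parts: [t^s * exp (- t)] vanishes at both ends and its
    derivative is the difference of the two kernels. *)
Lemma Gamma_succ s : 0 < s -> Gamma (s + 1) = s * Gamma s.
Proof.
  intros Hs. apply (is_RInt_pos_unique (gamma_kernel (s + 1))).
  assert (HD : is_RInt_pos (fun t => s * gamma_kernel s t - gamma_kernel (s + 1) t) (0 - 0)).
  { apply is_RInt_pos_derive with (fun t => Rpower t s * exp (- t)).
    - intros t Ht. unfold gamma_kernel, Rpower. auto_derive; [lra|].
      replace ((s - 1) * ln t) with (s * ln t + - ln t) by ring.
      rewrite exp_plus, (exp_Ropp (ln t)), exp_ln by lra.
      replace (s + 1 - 1) with s by ring. field. lra.
    - intros t Ht. apply (ex_derive_continuous (V := R_NormedModule)).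
      unfold gamma_kernel, Rpower. auto_derive. lra.
    - apply filterlim_locally. intros eps.
      destruct (proj1 (filterlim_locally _ _) (Rpower_lim_0 s Hs) eps) as [d Hd].
      exists d. intros t Ht Ht0. specialize (Hd t Ht Ht0).
      change (Rabs (Rpower t s - 0) < eps) in Hd.
      change (Rabs (Rpower t s * exp (- t) - 0) < eps).
      rewrite Rminus_0_r in *.
      assert (0 < Rpower t s) by apply exp_pos. assert (0 < exp (- t)) by apply exp_pos.
      assert (exp (- t) < 1) by (rewrite <- exp_0; apply exp_increasing; lra).
      rewrite Rabs_pos_eq in * by nra. nra.
    - now apply Rpower_exp_lim_p_infty. }
  assert (H1 := is_RInt_gen_scal (V := R_NormedModule) _ s _ (Gamma_correct s Hs)).
  assert (H2 := is_RInt_gen_minus (V := R_NormedModule) _ _ _ _ H1 HD).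
  unfold scal, minus, plus, opp, mult in H2; simpl in H2. unfold mult in H2; simpl in H2.
  replace (s * Gamma s) with (s * Gamma s + - (0 - 0)) by ring.
  refine (is_RInt_pos_ext _ _ _ _ H2). intros t Ht. unfold gamma_kernel. ring.
Qed.

(** For [s >= 1], the inequality [1 - exp (- t) <= t] puts the kernel above the
    derivative of [(1 - exp (- t))^s / s], whence [Gamma s >= 1 / s].  The recurrence
    reduces smaller [s] to this case. *)
Lemma Gamma_pos s : 0 < s -> 0 < Gamma s.
Proof.
  assert (H1 : forall p, 1 <= p -> 0 < Gamma p).
  { intros p Hp. apply Rlt_le_trans with (Rpower 1 p / p - 0 / p).
    { unfold Rpower, Rdiv. rewrite ln_1, Rmult_0_r, exp_0. rewrite Rmult_0_l, Rminus_0_r, Rmult_1_l.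
      apply Rinv_0_lt_compat. lra. }
    assert (He : forall t, 0 < t -> 0 < exp (- t) < 1).
    { intros t Ht. split; [apply exp_pos|]. rewrite <- exp_0. apply exp_increasing. lra. }
    apply (fun A B => is_RInt_pos_le (fun t => Rpower (1 - exp (- t)) (p - 1) * exp (- t)) _ _ _ A B
      (Gamma_correct p ltac:(lra))).
    - intros t Ht. specialize (He t Ht). unfold gamma_kernel.
      apply Rmult_le_compat_r; [lra|]. apply Rle_Rpower_l; [lra|].
      generalize (exp_ineq1_le (- t)). lra.
    - apply is_RInt_pos_derive with (fun t => Rpower (1 - exp (- t)) p / p).
      + intros t Ht. specialize (He t Ht). unfold Rpower. auto_derive; [repeat split; lra|].
        replace ((p - 1) * ln (1 - exp (- t))) with (p * ln (1 - exp (- t)) + - ln (1 - exp (- t))) by ring.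
        rewrite exp_plus, (exp_Ropp (ln _)), exp_ln by lra. unfold Rminus. field. lra.
      + intros t Ht. specialize (He t Ht). apply (ex_derive_continuous (V := R_NormedModule)).
        unfold Rpower. auto_derive. lra.
      + apply (filterlim_comp _ _ _ (fun t => 1 - exp (- t)) (fun u => Rpower u p / p) _ (at_right 0)).
        * intros P [e HP]. apply (near_0_pos _ e); [apply e|]. intros t [Ht0 Ht].
          specialize (He t Ht0). apply HP; [|lra].
          change (Rabs (1 - exp (- t) - 0) < e). rewrite Rminus_0_r, Rabs_pos_eq by lra.
          generalize (exp_ineq1_le (- t)). lra.
        * apply (filterlim_comp _ _ _ (fun u => Rpower u p) (fun v => v / p) _ (locally 0)).
          apply Rpower_lim_0. lra.
          apply (ex_derive_continuous (V := R_NormedModule) (fun v => v / p) 0). auto_derive. auto.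
      + apply (filterlim_comp _ _ _ (fun t => 1 - exp (- t)) (fun u => Rpower u p / p) _ (locally 1)).
        * apply filterlim_locally. intros e. exists (- ln e). intros t Ht.
          change (Rabs (1 - exp (- t) - 1) < e).
          replace (1 - exp (- t) - 1) with (- exp (- t)) by ring.
          rewrite Rabs_Ropp, Rabs_pos_eq by apply Rlt_le, exp_pos.
          rewrite <- (exp_ln e) by apply e. apply exp_increasing. lra.
        * apply (ex_derive_continuous (V := R_NormedModule) (fun u => Rpower u p / p) 1).
          unfold Rpower. auto_derive. repeat split; lra. }
  intros Hs. apply Rmult_lt_reg_l with s; auto.
  rewrite Rmult_0_r, <- Gamma_succ by auto. apply H1. lra.
Qed.

(** * Means against gamma densities *)

Definition gamma_mass (N s : R) : R := Gamma (s + 1) / Rpower N (s + 1).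

(** Multiplying by the mass, instead of dividing the integral by it, makes the
    relation linear in [f] with no side condition. *)
Definition is_gamma_mean (N s : R) (f : R -> R) (m : R) : Prop :=
  is_RInt_pos (fun t => exp (- N * t) * Rpower t s * f t) (m * gamma_mass N s).

Lemma gamma_mass_pos N s : 0 <= s -> 0 < gamma_mass N s.
Proof.
  intros Hs. apply Rdiv_lt_0_compat; [apply Gamma_pos; lra | apply exp_pos].
Qed.

Lemma gamma_weight_integral N s :
  0 < N -> 0 <= s -> is_RInt_pos (fun t => exp (- N * t) * Rpower t s) (gamma_mass N s).
Proof.
  intros HN Hs.
  assert (H := is_RInt_pos_scale _ N _ HN (Gamma_correct (s + 1) ltac:(lra))).
  apply (is_RInt_gen_scal (V := R_NormedModule) _ (/ Rpower N s)) in H.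
  unfold scal in H; simpl in H; unfold mult in H; simpl in H.
  unfold gamma_mass. rewrite Rpower_plus, Rpower_1 by auto.
  assert (HP : 0 < Rpower N s) by apply exp_pos.
  replace (Gamma (s + 1) / (Rpower N s * N)) with (/ Rpower N s * (Gamma (s + 1) / N))
    by (field; lra).
  refine (is_RInt_pos_ext _ _ _ _ H). intros t Ht. unfold gamma_kernel.
  replace (s + 1 - 1) with s by ring. rewrite <- Rpower_mult_distr by auto.
  replace (- (N * t)) with (- N * t) by ring. field. lra.
Qed.

Lemma is_gamma_mean_ext N s f g m :
  (forall t, 0 < t -> f t = g t) -> is_gamma_mean N s f m -> is_gamma_mean N s g m.
Proof.
  intros Hfg. apply is_RInt_pos_ext. intros t Ht. now rewrite Hfg.
Qed.

Lemma is_gamma_mean_lin N s f g mf mg c d :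
  is_gamma_mean N s f mf -> is_gamma_mean N s g mg ->
  is_gamma_mean N s (fun t => c * f t + d * g t) (c * mf + d * mg).
Proof.
  intros Hf Hg. unfold is_gamma_mean in *.
  apply (is_RInt_gen_scal (V := R_NormedModule) _ c) in Hf.
  apply (is_RInt_gen_scal (V := R_NormedModule) _ d) in Hg.
  assert (H := is_RInt_gen_plus (V := R_NormedModule) _ _ _ _ Hf Hg).
  unfold plus, scal in H; simpl in H; unfold mult in H; simpl in H.
  replace ((c * mf + d * mg) * gamma_mass N s)
    with (c * (mf * gamma_mass N s) + d * (mg * gamma_mass N s)) by ring.
  refine (is_RInt_pos_ext _ _ _ _ H). intros t Ht. ring.
Qed.

Lemma is_gamma_mean_le N s f g mf mg :
  0 <= s -> (forall t, 0 < t -> f t <= g t) ->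
  is_gamma_mean N s f mf -> is_gamma_mean N s g mg -> mf <= mg.
Proof.
  intros Hs Hfg Hf Hg. apply Rmult_le_reg_r with (gamma_mass N s).
  - now apply gamma_mass_pos.
  - refine (is_RInt_pos_le _ _ _ _ _ Hf Hg). intros t Ht.
    apply Rmult_le_compat_l; auto. apply Rmult_le_pos; apply Rlt_le, exp_pos.
Qed.

Lemma is_gamma_mean_1 N s : 0 < N -> 0 <= s -> is_gamma_mean N s (fun _ => 1) 1.
Proof.
  intros HN Hs. unfold is_gamma_mean. rewrite Rmult_1_l.
  refine (is_RInt_pos_ext _ _ _ _ (gamma_weight_integral N s HN Hs)).
  intros t Ht. ring.
Qed.

(** Multiplying by [t] raises the shape parameter, and the ratio of the two masses
    is [(s + 1) / N]; all moments follow from this recurrence. *)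
Lemma is_gamma_mean_mul_t N s f m :
  0 < N -> 0 <= s -> is_gamma_mean N (s + 1) f m ->
  is_gamma_mean N s (fun t => t * f t) ((s + 1) / N * m).
Proof.
  intros HN Hs Hf. unfold is_gamma_mean in *.
  replace ((s + 1) / N * m * gamma_mass N s) with (m * gamma_mass N (s + 1)).
  - refine (is_RInt_pos_ext _ _ _ _ Hf). intros t Ht.
    rewrite Rpower_plus, Rpower_1 by auto. ring.
  - unfold gamma_mass. rewrite (Gamma_succ (s + 1)) by lra.
    rewrite (Rpower_plus (s + 1) 1 N), Rpower_1 by auto.
    assert (0 < Rpower N (s + 1)) by apply exp_pos. field. lra.
Qed.

Lemma is_gamma_mean_dist N s x : 0 < N -> 0 <= s ->
  is_gamma_mean N s (fun t => t - x) ((s + 1) / N - x).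
Proof.
  intros HN Hs.
  assert (H := is_gamma_mean_lin N s _ _ _ _ 1 (- x)
    (is_gamma_mean_mul_t N s _ _ HN Hs (is_gamma_mean_1 N (s + 1) HN ltac:(lra)))
    (is_gamma_mean_1 N s HN Hs)).
  replace ((s + 1) / N - x) with (1 * ((s + 1) / N * 1) + - x * 1) by ring.
  refine (is_gamma_mean_ext _ _ _ _ _ _ H). intros t Ht. ring.
Qed.

Lemma is_gamma_mean_dist2 N s x : 0 < N -> 0 <= s ->
  is_gamma_mean N s (fun t => (t - x) ^ 2)
    ((s + 1) * (s + 2) / N ^ 2 - 2 * x * ((s + 1) / N) + x ^ 2).
Proof.
  intros HN Hs.
  assert (H := is_gamma_mean_lin N s _ _ _ _ 1 (- x)
    (is_gamma_mean_mul_t N s _ _ HN Hs (is_gamma_mean_dist N (s + 1) x HN ltac:(lra)))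
    (is_gamma_mean_dist N s x HN Hs)).
  replace ((s + 1) * (s + 2) / N ^ 2 - 2 * x * ((s + 1) / N) + x ^ 2)
    with (1 * ((s + 1) / N * ((s + 1 + 1) / N - x)) + - x * ((s + 1) / N - x)) by (field; lra).
  refine (is_gamma_mean_ext _ _ _ _ _ _ H). intros t Ht. ring.
Qed.

(** The same mean as a total function, in the form in which it occurs inside
    [Dstar]. *)
Definition gamma_mean (N s : R) (f : R -> R) : R :=
  Rpower N (s + 1) / Gamma (s + 1)
  * RInt_gen (fun t => exp (- N * t) * Rpower t s * f t) (at_right 0) (Rbar_locally p_infty).

Lemma is_gamma_mean_unique N s f m : 0 <= s -> is_gamma_mean N s f m -> gamma_mean N s f = m.
Proof.
  intros Hs Hf. unfold gamma_mean.
  rewrite (is_RInt_pos_unique _ _ Hf). unfold gamma_mass.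
  assert (0 < Rpower N (s + 1)) by apply exp_pos.
  assert (0 < Gamma (s + 1)) by (apply Gamma_pos; lra).
  field. lra.
Qed.

Lemma bounded_gamma_mean N s f B :
  0 < N -> 0 <= s -> (forall t, 0 < t -> continuous f t) ->
  (forall t, 0 < t -> Rabs (f t) <= B) -> is_gamma_mean N s f (gamma_mean N s f).
Proof.
  intros HN Hs Cf Bf.
  assert (Cw : forall t, 0 < t -> continuous (fun t => exp (- N * t) * Rpower t s) t).
  { intros t Ht. apply (ex_derive_continuous (V := R_NormedModule)).
    unfold Rpower. auto_derive. exact Ht. }
  assert (Hex : ex_RInt_pos (fun t => exp (- N * t) * Rpower t s * f t)).
  { apply ex_RInt_pos_dominated with (fun t => B * (exp (- N * t) * Rpower t s)).
    - intros t Ht. apply (continuous_mult (K := R_AbsRing)); auto.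
    - intros t Ht. apply (continuous_mult (K := R_AbsRing)); auto. apply continuous_const.
    - intros t Ht. rewrite Rabs_mult, Rabs_pos_eq, Rmult_comm.
      + apply Rmult_le_compat_r; auto. apply Rmult_le_pos; apply Rlt_le, exp_pos.
      + apply Rmult_le_pos; apply Rlt_le, exp_pos.
    - exists (B * gamma_mass N s).
      apply (is_RInt_gen_scal (V := R_NormedModule) _ B). now apply gamma_weight_integral. }
  destruct Hex as [l Hl].
  assert (Hm : is_gamma_mean N s f (l / gamma_mass N s)).
  { unfold is_gamma_mean. assert (H := gamma_mass_pos N s Hs).
    unfold Rdiv. rewrite Rmult_assoc, Rinv_l, Rmult_1_r by lra. exact Hl. }
  now rewrite (is_gamma_mean_unique _ _ _ _ Hs Hm).
Qed.

(** * Comparison of series *)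

Lemma is_series_le (u v : nat -> R) lu lv :
  (forall k, u k <= v k) -> is_series u lu -> is_series v lv -> lu <= lv.
Proof.
  intros Huv Hu Hv.
  apply (is_lim_seq_le (sum_n u) (sum_n v) lu lv); auto.
  intros k. apply sum_n_m_le. auto.
Qed.

Lemma ex_series_nonneg_le (u v : nat -> R) :
  (forall k, 0 <= u k <= v k) -> ex_series v -> ex_series u.
Proof.
  intros Huv. apply (ex_series_le (V := R_CompleteNormedModule)).
  intros k. change (Rabs (u k) <= v k). rewrite Rabs_pos_eq; apply Huv.
Qed.

Lemma ex_series_abs_nonneg (u : nat -> R) :
  (forall k, 0 <= u k) -> ex_series u -> ex_series (fun k => Rabs (u k)).
Proof. intros Hu. apply ex_series_ext. intros k. now rewrite Rabs_pos_eq. Qed.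

(** Bernoulli's inequality [1 + k h <= (sqrt r)^k] with [h = sqrt r - 1], squared. *)
Lemma square_le_geometric r K :
  1 < r -> 0 <= K -> exists C, forall k, (INR k + K) ^ 2 <= C * r ^ k.
Proof.
  intros Hr HK. set (h := sqrt r - 1).
  assert (Hh : 0 < h).
  { unfold h. apply Rlt_0_minus. rewrite <- sqrt_1. apply sqrt_lt_1; lra. }
  exists ((/ h + K) ^ 2). intros k.
  assert (Hk := pos_INR k).
  assert (Hih : 0 < / h) by now apply Rinv_0_lt_compat.
  assert (H1 : INR k + K <= (/ h + K) * (1 + INR k * h)).
  { replace ((/ h + K) * (1 + INR k * h)) with (INR k + K + / h + K * (INR k * h)) by (field; lra).
    assert (0 <= K * (INR k * h)) by (apply Rmult_le_pos; nra). lra. }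
  assert (H2 : 1 + INR k * h <= sqrt r ^ k).
  { replace (sqrt r) with (1 + h) by (unfold h; ring). now apply poly. }
  replace r with (sqrt r ^ 2) at 1 by (apply pow2_sqrt; lra).
  rewrite <- pow_mult, Nat.mul_comm, pow_mult, <- Rpow_mult_distr.
  apply pow_incr. split; [lra|].
  apply Rle_trans with (1 := H1). apply Rmult_le_compat_l; lra.
Qed.

Lemma is_series_dominated (u v : nat -> R) lv :
  (forall k, Rabs (u k) <= v k) -> is_series v lv ->
  exists lu : R, is_series u lu /\ Rabs lu <= lv.
Proof.
  intros Huv Hv.
  destruct (ex_series_le (V := R_CompleteNormedModule) u v Huv (ex_intro _ lv Hv)) as [lu Hlu].
  exists lu. split; [exact Hlu|]. apply Rabs_le. split.
  - apply (is_series_le (fun k => - v k) u); auto.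
    + intros k. specialize (Huv k). apply Rabs_le_between in Huv. lra.
    + now apply (is_series_opp (V := R_NormedModule)).
  - apply (is_series_le u v); auto.
    intros k. specialize (Huv k). apply Rabs_le_between in Huv. lra.
Qed.

Lemma is_series_lin (u v : nat -> R) lu lv c d :
  is_series u lu -> is_series v lv -> is_series (fun k => c * u k + d * v k) (c * lu + d * lv).
Proof.
  intros Hu Hv.
  exact (is_series_plus (V := R_NormedModule) _ _ _ _
    (is_series_scal (V := R_NormedModule) c _ _ Hu) (is_series_scal (V := R_NormedModule) d _ _ Hv)).
Qed.

(** * The terms of the Dunkl exponential *)

(** The Dunkl analogue of the integer [k]: the Dunkl operator sends [x^k] to this
    multiple of [x^(k-1)], and [gamma] is its factorial. *)
Definition dunkl_number (mu : R) (k : nat) : R := INR k + 2 * mu * theta k.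

Lemma theta_S k : theta (S k) = 1 - theta k.
Proof.
  unfold theta. rewrite Nat.even_succ, <- Nat.negb_even. destruct (Nat.even k); simpl; ring.
Qed.

Lemma theta_01 k : theta k = 0 \/ theta k = 1.
Proof. unfold theta. destruct (Nat.even k); auto. Qed.

Lemma theta_add m r : theta (m + r) = theta m + theta r - 2 * theta m * theta r.
Proof.
  induction m as [|m IH]; simpl.
  - change (theta 0) with 0. ring.
  - rewrite !theta_S, IH. ring.
Qed.

Lemma theta_even j : theta (2 * j) = 0.
Proof. unfold theta. now rewrite Nat.even_even. Qed.

Lemma dunkl_number_bounds mu k : 0 <= mu -> INR k <= dunkl_number mu k <= INR k + 2 * mu.
Proof.
  intros Hmu. unfold dunkl_number. destruct (theta_01 k) as [->| ->]; lra.
Qed.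

Lemma gamma_0 mu : 0 <= mu -> gamma mu 0 = 1.
Proof.
  intros Hmu. unfold gamma. simpl. rewrite Rplus_0_l.
  assert (0 < Gamma (mu + 1 / 2)) by (apply Gamma_pos; lra). field. lra.
Qed.

Lemma gamma_S mu k : 0 <= mu -> gamma mu (S k) = dunkl_number mu (S k) * gamma mu k.
Proof.
  intros Hmu. unfold dunkl_number. rewrite theta_S.
  assert (HG : 0 < Gamma (mu + 1 / 2)) by (apply Gamma_pos; lra).
  destruct (Nat.Even_or_Odd k) as [[j ->]|[j ->]].
  - assert (Hj := pos_INR j). rewrite theta_even.
    unfold gamma. rewrite Nat.even_succ, <- Nat.negb_even, Nat.even_even, Nat.div2_succ_double, Nat.div2_double.
    simpl negb. cbv iota.
    replace (INR j + mu + 3 / 2) with (INR j + mu + 1 / 2 + 1) by field.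
    rewrite Gamma_succ by lra.
    rewrite S_INR, mult_INR, pow_add, pow_1. change (INR 2) with 2.
    field. lra.
  - assert (Hj := pos_INR j). rewrite Nat.add_1_r, theta_S, theta_even.
    unfold gamma. replace (S (S (2 * j))) with (2 * S j)%nat by lia.
    rewrite Nat.even_succ, <- Nat.negb_even, !Nat.even_even, Nat.div2_succ_double, Nat.div2_double.
    simpl negb. cbv iota.
    replace (INR (S j) + mu + 1 / 2) with (INR j + mu + 3 / 2) by (rewrite S_INR; field).
    replace (2 * S j)%nat with (2 * j + 1 + 1)%nat at 1 by lia.
    rewrite (pow_add 2 (2 * j + 1) 1), pow_1.
    rewrite fact_simpl, !mult_INR. change (INR 2) with 2. rewrite S_INR. field. lra.
Qed.

Lemma gamma_ge_fact mu k : 0 <= mu -> INR (fact k) <= gamma mu k.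
Proof.
  intros Hmu. induction k as [|k IH].
  - rewrite gamma_0 by auto. simpl. lra.
  - rewrite gamma_S, fact_simpl, mult_INR by auto.
    assert (H1 := dunkl_number_bounds mu (S k) Hmu). assert (H2 := pos_INR (S k)).
    apply Rmult_le_compat; auto; [apply pos_INR | lra].
Qed.

Lemma gamma_pos mu k : 0 <= mu -> 0 < gamma mu k.
Proof.
  intros Hmu. apply Rlt_le_trans with (INR (fact k)); [apply INR_fact_lt_0 | now apply gamma_ge_fact].
Qed.

Definition dunkl_term (mu y : R) (m : nat) : R := y ^ m / gamma mu m.

Lemma dunkl_term_nonneg mu y m : 0 <= mu -> 0 <= y -> 0 <= dunkl_term mu y m.
Proof.
  intros Hmu Hy. apply Rdiv_le_0_compat; [now apply pow_le | now apply gamma_pos].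
Qed.

Lemma dunkl_term_summable mu y : 0 <= mu -> 0 <= y -> ex_series (dunkl_term mu y).
Proof.
  intros Hmu Hy. apply ex_series_nonneg_le with (fun k => / INR (fact k) * y ^ k).
  - intros k. split; [now apply dunkl_term_nonneg|].
    unfold dunkl_term, Rdiv. rewrite Rmult_comm. apply Rmult_le_compat_r; [now apply pow_le|].
    apply Rinv_le_contravar; [apply INR_fact_lt_0 | now apply gamma_ge_fact].
  - exists (exp y). apply is_pseries_R, is_exp_Reals.
Qed.

Lemma dunkl_exp_series mu y :
  0 <= mu -> 0 <= y -> is_series (dunkl_term mu y) (dunkl_exp mu y).
Proof.
  intros Hmu Hy. unfold dunkl_exp, PSeries.
  rewrite (Series_ext _ (dunkl_term mu y)).
  - now apply Series_correct, dunkl_term_summable.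
  - intros k. unfold dunkl_term, Rdiv. ring.
Qed.

Lemma dunkl_exp_pos mu y : 0 <= mu -> 0 <= y -> 0 < dunkl_exp mu y.
Proof.
  intros Hmu Hy. apply Rlt_le_trans with 1; [lra|].
  apply (is_series_le (fun k => match k with O => 1 | _ => 0 end) (dunkl_term mu y)).
  - intros [|k].
    + unfold dunkl_term. rewrite gamma_0 by auto. simpl. lra.
    + now apply dunkl_term_nonneg.
  - apply (is_series_decr_1 (V := R_NormedModule)). unfold plus, opp; simpl.
    replace (1 + - (1)) with 0 by ring.
    apply (filterlim_ext (fun _ => 0)); [|apply filterlim_const].
    intros k. symmetry. unfold sum_n. apply (sum_n_m_const_zero (G := R_AbelianMonoid)).
  - now apply dunkl_exp_series.
Qed.

Lemma dunkl_term_recurrence mu y m : 0 <= mu ->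
  dunkl_term mu y (S m) * dunkl_number mu (S m) = y * dunkl_term mu y m.
Proof.
  intros Hmu. unfold dunkl_term. rewrite gamma_S by auto.
  assert (0 < gamma mu m) by now apply gamma_pos.
  assert (0 < dunkl_number mu (S m)).
  { assert (H1 := dunkl_number_bounds mu (S m) Hmu). rewrite S_INR in H1.
    assert (H2 := pos_INR m). lra. }
  simpl. field. lra.
Qed.

(** The recurrence [c_m * dunkl_number m = y * c_(m-1)] shifts the series of [e_mu y]. *)
Lemma dunkl_term_mean mu y : 0 <= mu -> 0 <= y ->
  is_series (fun m => dunkl_term mu y m * dunkl_number mu m) (y * dunkl_exp mu y).
Proof.
  intros Hmu Hy. apply (is_series_decr_1 (V := R_NormedModule)).
  assert (H0 : dunkl_number mu 0 = 0) by (unfold dunkl_number, theta; simpl; ring).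
  rewrite H0, Rmult_0_r. unfold plus, opp; simpl. rewrite Ropp_0, Rplus_0_r.
  apply is_series_ext with (fun m => y * dunkl_term mu y m).
  - intros m. symmetry. now apply dunkl_term_recurrence.
  - apply (is_series_scal (V := R_NormedModule) y). now apply dunkl_exp_series.
Qed.

(** This is the increment [dunkl_number (m + 1) - dunkl_number m], since
    [theta (m + 1) - theta m = 1 - 2 * theta m]. *)
Definition parity_gap (mu : R) (m : nat) : R := 1 + 2 * mu * (1 - 2 * theta m).

(** The sum is [e_mu y + 2 mu e_mu (- y)].  For [mu <= 1 / 2] every term is
    nonnegative.  For [mu > 1 / 2] only the odd terms are negative; the recurrence
    gives [c_(2j+1)^2 <= c_(2j) * c_(2j+2)] because
    [2 j + 2 <= 2 j + 1 + 2 mu], so an odd term is at most the mean of its two even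
    neighbours, whose positive contributions absorb it. *)
Lemma parity_gap_series_nonneg mu y l : 0 <= mu -> 0 <= y ->
  is_series (fun m => dunkl_term mu y m * parity_gap mu m) l -> 0 <= l.
Proof.
  intros Hmu Hy Hl.
  assert (Hc := fun m => dunkl_term_nonneg mu y m Hmu Hy).
  destruct (Rle_dec mu (1 / 2)) as [Hm|Hm].
  - apply (is_lim_seq_le (fun _ => 0) (sum_n (fun m => dunkl_term mu y m * parity_gap mu m)) 0 l); auto.
    + intros k. induction k as [|k IH]; [rewrite sum_O|rewrite sum_Sn; apply Rplus_le_le_0_compat; auto];
        apply Rmult_le_pos; auto;
        unfold parity_gap; [destruct (theta_01 0) as [->| ->] | destruct (theta_01 (S k)) as [->| ->]]; lra.
    + apply is_lim_seq_const.
  - set (u := fun m => dunkl_term mu y m * parity_gap mu m) in *.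
    assert (Hodd : forall j, dunkl_term mu y (2 * j + 1) <=
       (dunkl_term mu y (2 * j) + dunkl_term mu y (2 * j + 2)) / 2).
    { intros j. assert (H1 := dunkl_term_recurrence mu y (2 * j) Hmu).
      assert (H2 := dunkl_term_recurrence mu y (2 * j + 1) Hmu).
      replace (2 * j + 2)%nat with (S (2 * j + 1)) by lia.
      replace (S (2 * j)) with (2 * j + 1)%nat in H1 by lia.
      unfold dunkl_number in H1, H2. rewrite theta_S in H2.
      assert (Ht : theta (2 * j + 1) = 1).
      { rewrite Nat.add_1_r, theta_S, theta_even. ring. }
      rewrite Ht in H1, H2. rewrite S_INR in H2. rewrite plus_INR in H1, H2.
      change (INR 1) with 1 in H1, H2.
      assert (Hj := pos_INR (2 * j)).
      assert (c0 := Hc (2 * j)%nat). assert (c1 := Hc (2 * j + 1)%nat).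
      assert (c2 := Hc (S (2 * j + 1))).
      set (p := dunkl_term mu y (2 * j)) in *. set (q := dunkl_term mu y (2 * j + 1)) in *.
      set (s := dunkl_term mu y (S (2 * j + 1))) in *. set (J := INR (2 * j)) in *.
      destruct (Req_dec y 0) as [Hy0|Hy0].
      - rewrite Hy0, Rmult_0_l in H1. assert (q = 0) by nra. lra.
      - assert (Hq : q * q <= p * s).
        { assert (H3 : s * (J + 2) * p = y * q * p) by nra.
          assert (H4 : y * p * q = q * (J + 1 + 2 * mu) * q) by nra.
          assert (0 <= q * q) by nra.
          assert (q * q * (J + 2) <= p * s * (J + 2)) by nra.
          nra. }
        assert (0 <= (p - s) ^ 2) by apply pow2_ge_0. nra. }
    (* The share [mu] of the latest even term, more than [mu - 1 / 2], is kept in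
       reserve to pay for the next odd term. *)
    assert (HS : forall j, mu * dunkl_term mu y (2 * j) <= sum_n u (2 * j)).
    { induction j as [|j IH].
      - simpl. rewrite sum_O. unfold u, parity_gap, theta. simpl. assert (c0 := Hc 0%nat). nra.
      - replace (2 * S j)%nat with (S (S (2 * j))) by lia. rewrite !sum_Sn.
        unfold plus; simpl plus. unfold u at 2 3, parity_gap. rewrite !theta_S, theta_even.
        specialize (Hodd j). replace (2 * j + 2)%nat with (S (S (2 * j))) in Hodd by lia.
        replace (2 * j + 1)%nat with (S (2 * j)) in Hodd by lia.
        assert (c0 := Hc (2 * j)%nat). assert (c1 := Hc (S (2 * j))).
        assert (c2 := Hc (S (S (2 * j)))).
        change (mu * dunkl_term mu y (S (S (2 * j))) <=
          sum_n u (2 * j) + dunkl_term mu y (S (2 * j)) * (1 + 2 * mu * (1 - 2 * (1 - 0)))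
          + dunkl_term mu y (S (S (2 * j))) * (1 + 2 * mu * (1 - 2 * (1 - (1 - 0))))).
        nra. }
    apply (is_lim_seq_le (fun _ => 0) (fun j => sum_n u (2 * j)) 0 l).
    + intros j. apply Rle_trans with (2 := HS j). apply Rmult_le_pos; auto.
    + apply is_lim_seq_const.
    + apply (is_lim_seq_subseq (sum_n u) l (fun j => (2 * j)%nat)); auto.
      apply eventually_subseq. intros j. lia.
Qed.

(** * The Dunkl-Appell weights *)

Section AppellWeights.

Variables (mu : R) (a : nat -> R) (rho : R).
Hypothesis mu_nonneg : 0 <= mu.
Hypothesis rho_gt_1 : 1 < rho.
Hypothesis rho_radius : Rbar_le (Finite rho) (CV_radius (A_coef mu a)).
Hypothesis A1_neq_0 : A_fun mu a 1 <> 0.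
Hypothesis a_sign : forall r : nat, 0 <= a r / A_fun mu a 1.

Definition appell_factor (r : nat) : R := A_coef mu a r / A_fun mu a 1.

Lemma appell_factor_nonneg r : 0 <= appell_factor r.
Proof.
  assert (Hg := gamma_pos mu r mu_nonneg). unfold appell_factor, A_coef.
  replace (a r / gamma mu r / A_fun mu a 1) with (a r / A_fun mu a 1 / gamma mu r)
    by (field; lra).
  now apply Rdiv_le_0_compat.
Qed.

Lemma appell_factor_geometric : exists r, 1 < r /\ ex_series (fun k => appell_factor k * r ^ k).
Proof.
  (* Any point strictly between [1] and [rho]. *)
  exists ((1 + rho) / 2). split; [lra|].
  assert (H : ex_series (fun k => Rabs (A_coef mu a k * ((1 + rho) / 2) ^ k))).
  { apply CV_disk_inside. rewrite Rabs_pos_eq by lra.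
    apply Rbar_lt_le_trans with (2 := rho_radius). simpl. lra. }
  apply ex_series_Rabs in H.
  apply (ex_series_scal_r (/ A_fun mu a 1)) in H.
  apply ex_series_ext with (2 := H). intros k. unfold appell_factor, Rdiv. simpl. ring.
Qed.

Lemma appell_factor_series : is_series appell_factor 1.
Proof.
  assert (H : ex_series appell_factor).
  { destruct appell_factor_geometric as [r [Hr H]].
    apply ex_series_nonneg_le with (2 := H). intros k.
    assert (H1 := appell_factor_nonneg k). assert (H2 := pow_R1_Rle r k ltac:(lra)).
    split; [auto|nra]. }
  replace 1 with (Series appell_factor); [now apply Series_correct|].
  unfold appell_factor at 1. unfold Rdiv. rewrite Series_scal_r.
  replace (Series (A_coef mu a)) with (A_fun mu a 1); [now field|].
  unfold A_fun, PSeries. apply Series_ext. intros k. rewrite pow1. ring.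
Qed.

Variable y : R.
Hypothesis y_nonneg : 0 <= y.

Definition appell_weight (k : nat) : R :=
  dunkl_appell mu a k y / gamma mu k / (dunkl_exp mu y * A_fun mu a 1).

Lemma appell_weight_convolution k :
  appell_weight k * dunkl_exp mu y
  = sum_f_R0 (fun m => dunkl_term mu y m * appell_factor (k - m)) k.
Proof.
  assert (He := dunkl_exp_pos mu y mu_nonneg y_nonneg).
  assert (Hk := gamma_pos mu k mu_nonneg).
  unfold appell_weight.
  replace (dunkl_appell mu a k y / gamma mu k / (dunkl_exp mu y * A_fun mu a 1) * dunkl_exp mu y)
    with (/ (gamma mu k * A_fun mu a 1) * dunkl_appell mu a k y) by (field; lra).
  unfold dunkl_appell. rewrite scal_sum. apply sum_eq. intros m Hm.
  unfold dunkl_term, appell_factor, A_coef.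
  assert (H1 := gamma_pos mu m mu_nonneg). assert (H2 := gamma_pos mu (k - m) mu_nonneg).
  field. lra.
Qed.

Lemma appell_weight_nonneg k : 0 <= appell_weight k.
Proof.
  assert (He := dunkl_exp_pos mu y mu_nonneg y_nonneg).
  apply Rmult_le_reg_r with (1 := He). rewrite Rmult_0_l, appell_weight_convolution.
  apply cond_pos_sum. intros m.
  apply Rmult_le_pos; [now apply dunkl_term_nonneg | apply appell_factor_nonneg].
Qed.

Lemma appell_weight_series : is_series appell_weight 1.
Proof.
  assert (He := dunkl_exp_pos mu y mu_nonneg y_nonneg).
  assert (H := is_series_mult_pos _ _ _ _ (dunkl_exp_series mu y mu_nonneg y_nonneg)
    appell_factor_series (fun m => dunkl_term_nonneg mu y m mu_nonneg y_nonneg)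
    appell_factor_nonneg).
  apply (is_series_scal_r (/ dunkl_exp mu y)) in H.
  replace (dunkl_exp mu y * 1 * / dunkl_exp mu y) with 1 in H by (field; lra).
  apply is_series_ext with (2 := H). intros k. rewrite <- appell_weight_convolution. change (appell_weight k * dunkl_exp mu y * / dunkl_exp mu y = appell_weight k). field. lra.
Qed.

(** The radius of [A] exceeds [1], so the convolution still converges with a factor
    [r^k], [r > 1], which dominates every quadratic polynomial in [k]. *)
Lemma appell_weight_second_moment K : 0 <= K ->
  ex_series (fun k => appell_weight k * (INR k + K) ^ 2).
Proof.
  intros HK.
  assert (He := dunkl_exp_pos mu y mu_nonneg y_nonneg).
  destruct appell_factor_geometric as [r [Hr [lw Hw]]].
  destruct (square_le_geometric r K Hr HK) as [C HC].
  assert (Hry : 0 <= r * y) by (apply Rmult_le_pos; lra).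
  assert (Hr0 : forall k, 0 <= r ^ k) by (intros k; apply pow_le; lra).
  assert (H := is_series_mult_pos _ _ _ _ (dunkl_exp_series mu (r * y) mu_nonneg Hry)
    Hw (fun m => dunkl_term_nonneg mu _ m mu_nonneg Hry)
    (fun k => Rmult_le_pos _ _ (appell_factor_nonneg k) (Hr0 k))).
  apply (is_series_scal_r (C / dunkl_exp mu y)) in H.
  refine (ex_series_nonneg_le _ _ _ (ex_intro _ _ H)). intros k. split.
  - apply Rmult_le_pos; [apply appell_weight_nonneg | apply pow2_ge_0].
  - apply Rle_trans with (appell_weight k * (C * r ^ k)).
    { apply Rmult_le_compat_l; [apply appell_weight_nonneg | apply HC]. }
    apply Req_le.
    replace (sum_f_R0 _ k) with (r ^ k * (appell_weight k * dunkl_exp mu y)); [field; lra|].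
    rewrite appell_weight_convolution, scal_sum. apply sum_eq. intros m Hm.
    replace k with (m + (k - m))%nat at 2 by lia.
    unfold dunkl_term. rewrite pow_add, Rpow_mult_distr. unfold Rdiv. ring.
Qed.

(** Under the convolution, [k = m + r] and
    [dunkl_number (m + r) >= dunkl_number m + parity_gap m * theta r]: equality up to
    the excess [r - theta r >= 0].  Summing the right side factors into products of
    series, [y * e_mu y * 1] plus a product of two nonnegative sums. *)
Lemma appell_weight_mean l :
  is_series (fun k => appell_weight k * dunkl_number mu k) l -> y <= l.
Proof.
  intros Hl.
  assert (He := dunkl_exp_pos mu y mu_nonneg y_nonneg).
  assert (Hc := fun m => dunkl_term_nonneg mu y m mu_nonneg y_nonneg).
  assert (Hw := appell_factor_nonneg).
  assert (Hgap : ex_series (fun m => Rabs (dunkl_term mu y m * parity_gap mu m))).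
  { apply ex_series_nonneg_le with (fun m => dunkl_term mu y m * (1 + 2 * mu)).
    - intros m. split; [apply Rabs_pos|]. rewrite Rabs_mult, (Rabs_pos_eq (dunkl_term mu y m)) by auto.
      apply Rmult_le_compat_l; auto. unfold parity_gap. apply Rabs_le.
      destruct (theta_01 m) as [->| ->]; lra.
    - apply ex_series_scal_r. now apply dunkl_term_summable. }
  assert (Hodd : ex_series (fun r => appell_factor r * theta r)).
  { apply ex_series_nonneg_le with appell_factor.
    - intros r. specialize (Hw r). destruct (theta_01 r) as [->| ->]; lra.
    - exists 1. apply appell_factor_series. }
  assert (Hodd0 : forall r, 0 <= appell_factor r * theta r).
  { intros r. specialize (Hw r). destruct (theta_01 r) as [->| ->]; lra. }
  assert (Hmean0 : forall m, 0 <= dunkl_term mu y m * dunkl_number mu m).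
  { intros m. apply Rmult_le_pos; auto.
    apply Rle_trans with (INR m); [apply pos_INR | now apply dunkl_number_bounds]. }
  assert (S1 := is_series_mult_pos _ _ _ _ (dunkl_term_mean mu y mu_nonneg y_nonneg)
    appell_factor_series Hmean0 Hw).
  destruct (ex_series_Rabs _ Hgap) as [g Hg]. destruct Hodd as [o Ho].
  assert (Hg0 := parity_gap_series_nonneg mu y g mu_nonneg y_nonneg Hg).
  assert (Ho0 : 0 <= o).
  { refine (is_series_le (fun _ => 0) _ _ _ Hodd0 _ Ho).
    apply (filterlim_ext (fun _ => 0)); [|apply filterlim_const].
    intros k. symmetry. apply (sum_n_m_const_zero (G := R_AbelianMonoid)). }
  assert (S2 := is_series_mult _ _ _ _ Hg Ho Hgap
    (ex_series_abs_nonneg _ Hodd0 (ex_intro _ o Ho))).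
  assert (S3 := is_series_plus (V := R_NormedModule) _ _ _ _ S1 S2).
  apply (is_series_scal_r (dunkl_exp mu y)) in Hl.
  assert (Hfin := fun H => is_series_le _ _ _ _ H S3 Hl).
  unfold plus in Hfin; simpl in Hfin.
  apply Rmult_le_reg_r with (1 := He).
  apply Rle_trans with (y * dunkl_exp mu y * 1 + g * o).
  { assert (0 <= g * o) by now apply Rmult_le_pos. lra. }
  apply Hfin. intros k.
  rewrite <- sum_plus.
  replace (appell_weight k * dunkl_number mu k * dunkl_exp mu y)
    with (dunkl_number mu k * (appell_weight k * dunkl_exp mu y)) by ring.
  rewrite appell_weight_convolution, scal_sum.
  apply sum_Rle. intros m Hm.
  replace (dunkl_term mu y m * dunkl_number mu m * appell_factor (k - m) +
    dunkl_term mu y m * parity_gap mu m * (appell_factor (k - m) * theta (k - m)))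
    with (dunkl_term mu y m * appell_factor (k - m)
          * (dunkl_number mu m + parity_gap mu m * theta (k - m))) by ring.
  apply Rmult_le_compat_l; [now apply Rmult_le_pos|].
  set (r := (k - m)%nat). replace k with (m + r)%nat by (unfold r; lia).
  unfold dunkl_number, parity_gap. rewrite theta_add, plus_INR.
  assert (Hr : theta r <= INR r).
  { destruct r as [|r']; [unfold theta; simpl; lra|].
    assert (H := pos_INR r'). rewrite S_INR. destruct (theta_01 (S r')) as [->| ->]; lra. }
  nra.
Qed.

End AppellWeights.

(** * The operator as a mixture of gamma means *)

Section Operator.

Variables (mu lam : R) (a : nat -> R) (rho : R).
Hypothesis mu_nonneg : 0 <= mu.
Hypothesis lam_nonneg : 0 <= lam.
Hypothesis rho_gt_1 : 1 < rho.
Hypothesis rho_radius : Rbar_le (Finite rho) (CV_radius (A_coef mu a)).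
Hypothesis A1_neq_0 : A_fun mu a 1 <> 0.
Hypothesis a_sign : forall r : nat, 0 <= a r / A_fun mu a 1.
Variables (n : nat) (x : R).
Hypothesis n_pos : (1 <= n)%nat.
Hypothesis x_nonneg : 0 <= x.

Let N := INR n.
Let P := appell_weight mu a (N * x).
Let s k := dunkl_number mu k + lam.

Lemma scale_pos : 0 < N.
Proof. apply lt_0_INR. lia. Qed.

Lemma node_nonneg : 0 <= N * x.
Proof. apply Rmult_le_pos; auto. apply Rlt_le, scale_pos. Qed.

Lemma shape_bounds k : 0 <= s k <= INR k + (2 * mu + lam).
Proof.
  unfold s. assert (H := dunkl_number_bounds mu k mu_nonneg). assert (H1 := pos_INR k). lra.
Qed.

Lemma weight_nonneg k : 0 <= P k.
Proof. apply (appell_weight_nonneg mu a); auto. apply node_nonneg. Qed.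

Lemma weight_series : is_series P 1.
Proof. apply (appell_weight_series mu a rho); auto. apply node_nonneg. Qed.

Lemma Dstar_mixture f : Dstar mu lam a n f x = Series (fun k => P k * gamma_mean N (s k) f).
Proof.
  unfold Dstar. rewrite <- Series_scal_l. apply Series_ext. intros k.
  unfold P, appell_weight, gamma_mean, s, dunkl_number.
  fold N. unfold Rdiv. ring.
Qed.

Lemma Dstar_value f m l :
  (forall k, is_gamma_mean N (s k) f (m k)) -> is_series (fun k => P k * m k) l ->
  Dstar mu lam a n f x = l.
Proof.
  intros Hm Hl. rewrite Dstar_mixture. apply is_series_unique.
  apply is_series_ext with (2 := Hl). intros k. f_equal. symmetry.
  apply is_gamma_mean_unique; auto. apply shape_bounds.
Qed.

Lemma weight_moments : exists S1 S2,
  is_series (fun k => P k * (s k + 1)) S1 /\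
  is_series (fun k => P k * ((s k + 1) * (s k + 2))) S2 /\ N * x + 1 <= S1.
Proof.
  assert (HK : 0 <= 2 * mu + lam + 2) by lra.
  assert (HM := appell_weight_second_moment mu a rho mu_nonneg rho_gt_1 rho_radius A1_neq_0 a_sign
    (N * x) node_nonneg _ HK).
  fold P in HM.
  assert (Hd : ex_series (fun k => P k * dunkl_number mu k)).
  { apply ex_series_nonneg_le with (2 := HM). intros k.
    assert (H0 := weight_nonneg k). assert (H1 := dunkl_number_bounds mu k mu_nonneg).
    assert (H2 := pos_INR k). split; [apply Rmult_le_pos; lra|].
    apply Rmult_le_compat_l; auto. nra. }
  assert (H2 : ex_series (fun k => P k * ((s k + 1) * (s k + 2)))).
  { apply ex_series_nonneg_le with (2 := HM). intros k.
    assert (H0 := weight_nonneg k). assert (H1 := shape_bounds k). split.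
    - apply Rmult_le_pos; auto. nra.
    - apply Rmult_le_compat_l; auto. assert (H2 := pos_INR k). nra. }
  destruct Hd as [d Hd]. destruct H2 as [S2 H2].
  assert (Hnode : N * x <= d).
  { apply (appell_weight_mean mu a rho) with (y := N * x); auto. apply node_nonneg. }
  exists (1 * d + (lam + 1) * 1), S2. split; [|split; auto; lra].
  refine (is_series_ext _ _ _ _ (is_series_lin _ _ _ _ 1 (lam + 1) Hd weight_series)).
  intros k. unfold s. change (1 * (P k * dunkl_number mu k) + (lam + 1) * P k
    = P k * (dunkl_number mu k + lam + 1)). ring.
Qed.

Lemma Omega1_series :
  is_series (fun k => P k * ((s k + 1) / N - x)) (Omega1 mu lam a n x).
Proof.
  destruct weight_moments as [S1 [S2 [H1 [H2 H3]]]].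
  assert (HS : is_series (fun k => P k * ((s k + 1) / N - x)) (/ N * S1 + - x * 1)).
  { refine (is_series_ext _ _ _ _ (is_series_lin _ _ _ _ (/ N) (- x) H1 weight_series)).
    intros k. change (/ N * (P k * (s k + 1)) + - x * P k = P k * ((s k + 1) / N - x)).
    unfold Rdiv. ring. }
  unfold Omega1.
  rewrite (Dstar_value _ _ _ (fun k => is_gamma_mean_dist N (s k) x scale_pos
    (proj1 (shape_bounds k))) HS).
  exact HS.
Qed.

Lemma Omega2_series :
  is_series (fun k => P k * ((s k + 1) * (s k + 2) / N ^ 2 - 2 * x * ((s k + 1) / N) + x ^ 2))
    (Omega2 mu lam a n x).
Proof.
  destruct weight_moments as [S1 [S2 [H1 [H2 H3]]]].
  set (m := fun k => (s k + 1) * (s k + 2) / N ^ 2 - 2 * x * ((s k + 1) / N) + x ^ 2).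
  assert (HS : is_series (fun k => P k * m k)
    (1 * (/ N ^ 2 * S2 + - (2 * x / N) * S1) + x ^ 2 * 1)).
  { refine (is_series_ext _ _ _ _ (is_series_lin _ _ _ _ 1 (x ^ 2)
      (is_series_lin _ _ _ _ (/ N ^ 2) (- (2 * x / N)) H2 H1) weight_series)).
    intros k. change (1 * (/ N ^ 2 * (P k * ((s k + 1) * (s k + 2)))
      + - (2 * x / N) * (P k * (s k + 1))) + x ^ 2 * P k = P k * m k).
    unfold m, Rdiv. ring. }
  unfold Omega2.
  rewrite (Dstar_value _ _ _ (fun k => is_gamma_mean_dist2 N (s k) x scale_pos
    (proj1 (shape_bounds k))) HS).
  exact HS.
Qed.

Lemma Omega1_pos : 0 < Omega1 mu lam a n x.
Proof.
  destruct weight_moments as [S1 [S2 [H1 [H2 H3]]]].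
  assert (HS := is_series_lin _ _ _ _ (/ N) (- x) H1 weight_series).
  assert (HN := scale_pos).
  rewrite <- (is_series_unique _ _ Omega1_series).
  rewrite (Series_ext _ (fun k => / N * (P k * (s k + 1)) + - x * P k)).
  2:{ intros k. unfold Rdiv. ring. }
  rewrite (is_series_unique _ _ HS).
  apply Rmult_lt_reg_l with N; auto.
  replace (N * (/ N * S1 + - x * 1)) with (S1 - N * x) by (field; lra). lra.
Qed.

(** Each gamma mean of [(t - x)^2] is the squared bias plus the variance
    [(s + 1) / N^2]. *)
Lemma Omega2_nonneg : 0 <= Omega2 mu lam a n x.
Proof.
  assert (HN := scale_pos).
  set (m := fun k => (s k + 1) * (s k + 2) / N ^ 2 - 2 * x * ((s k + 1) / N) + x ^ 2).
  destruct (is_series_dominated (fun _ => 0) (fun k => P k * m k) (Omega2 mu lam a n x))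
    as [l [_ Hl]]; [|apply Omega2_series|assert (H := Rabs_pos l); lra].
  intros k. rewrite Rabs_R0. apply Rmult_le_pos; [apply weight_nonneg|].
  assert (Hs := shape_bounds k).
  replace (m k) with (((s k + 1) / N - x) ^ 2 + (s k + 1) / N ^ 2) by (unfold m; field; lra).
  assert (0 <= (s k + 1) / N ^ 2) by (apply Rdiv_le_0_compat; [lra | nra]).
  assert (H0 := pow2_ge_0 ((s k + 1) / N - x)). lra.
Qed.

(** Positivity of the mixture, applied to the error of an affine approximation whose
    first two central moments are [Omega1] and [Omega2]. *)
Lemma Dstar_affine_defect f B F G K L :
  (forall t, 0 < t -> continuous f t) -> (forall t, 0 < t -> Rabs (f t) <= B) ->
  (forall t, 0 < t -> Rabs (f t - (F + G * (t - x))) <= K + L * (t - x) ^ 2) ->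
  Rabs (Dstar mu lam a n f x - (F + G * Omega1 mu lam a n x)) <= K + L * Omega2 mu lam a n x.
Proof.
  intros Cf Bf Hf.
  set (m1 := fun k => (s k + 1) / N - x).
  set (m2 := fun k => (s k + 1) * (s k + 2) / N ^ 2 - 2 * x * ((s k + 1) / N) + x ^ 2).
  set (m := fun k => gamma_mean N (s k) f).
  assert (HN := scale_pos). assert (Hs := fun k => proj1 (shape_bounds k)).
  assert (Hm : forall k, is_gamma_mean N (s k) f (m k)).
  { intros k. now apply bounded_gamma_mean with B. }
  assert (H0 := fun k => is_gamma_mean_1 N (s k) HN (Hs k)).
  assert (H1 : forall k, is_gamma_mean N (s k) (fun t => t - x) (m1 k)).
  { intros k. now apply is_gamma_mean_dist. }
  assert (H2 : forall k, is_gamma_mean N (s k) (fun t => (t - x) ^ 2) (m2 k)).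
  { intros k. now apply is_gamma_mean_dist2. }
  set (d := fun k => m k - (F + G * m1 k)).
  assert (Hd : forall k, Rabs (d k) <= K + L * m2 k).
  { intros k.
    assert (Hdk := is_gamma_mean_lin _ _ _ _ _ _ 1 (-1) (Hm k)
       (is_gamma_mean_lin _ _ _ _ _ _ F G (H0 k) (H1 k))).
    assert (Hbk := is_gamma_mean_lin _ _ _ _ _ _ K L (H0 k) (H2 k)).
    assert (Hnk := is_gamma_mean_lin _ _ _ _ _ _ (-1) 0 Hbk Hbk).
    assert (U := fun h => is_gamma_mean_le _ _ _ _ _ _ (Hs k) h Hdk Hbk).
    assert (V := fun h => is_gamma_mean_le _ _ _ _ _ _ (Hs k) h Hnk Hdk).
    unfold d. apply Rabs_le. split.
    - refine (Rle_trans _ _ _ _ (Rle_trans _ _ _ (V _) _)).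
      + apply Req_le. ring.
      + intros t Ht. specialize (Hf t Ht). apply Rabs_le_between in Hf. simpl in Hf. lra.
      + apply Req_le. ring.
    - refine (Rle_trans _ _ _ _ (Rle_trans _ _ _ (U _) _)).
      + apply Req_le. ring.
      + intros t Ht. specialize (Hf t Ht). apply Rabs_le_between in Hf. simpl in Hf. lra.
      + apply Req_le. ring. }
  destruct (is_series_dominated (fun k => P k * d k) (fun k => K * P k + L * (P k * m2 k))
    (K * 1 + L * Omega2 mu lam a n x)) as [l [Hl Hle]].
  - intros k. rewrite Rabs_mult, Rabs_pos_eq by apply weight_nonneg.
    replace (K * P k + L * (P k * m2 k)) with (P k * (K + L * m2 k)) by ring.
    apply Rmult_le_compat_l; auto. apply weight_nonneg.
  - apply is_series_lin; [apply weight_series | apply Omega2_series].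
  - rewrite (Dstar_value f m (1 * l + 1 * (F * 1 + G * Omega1 mu lam a n x))); auto.
    + replace (1 * l + 1 * (F * 1 + G * Omega1 mu lam a n x) - (F + G * Omega1 mu lam a n x))
        with l by ring. lra.
    + refine (is_series_ext _ _ _ _ (is_series_lin _ _ _ _ 1 1 Hl
        (is_series_lin _ _ _ _ F G weight_series Omega1_series))).
      intros k. change (1 * (P k * d k) + 1 * (F * P k + G * (P k * m1 k)) = P k * m k).
      unfold d. ring.
Qed.

End Operator.

(** * The norm and the second modulus *)

Lemma real_Lub_ub (E : R -> Prop) B z :
  (forall u, E u -> u <= B) -> E z -> z <= real (Lub_Rbar E) <= B.
Proof.
  intros HB Hz. destruct (Lub_Rbar_correct E) as [H1 H2].
  assert (H3 := H1 z Hz). assert (H4 := H2 (Finite B) HB).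
  destruct (Lub_Rbar E); simpl in *; try contradiction. lra.
Qed.

Lemma norm_CB_bounds f B x :
  (forall u, 0 <= u -> Rabs (f u) <= B) -> 0 <= x -> Rabs (f x) <= norm_CB f <= B.
Proof.
  intros HB Hx. apply real_Lub_ub.
  - intros u [v [Hv ->]]. auto.
  - exists x. auto.
Qed.

Lemma omega2_bound f B d t x :
  (forall u, 0 <= u -> Rabs (f u) <= B) -> 0 < t <= d -> 0 <= x ->
  Rabs (f (x + 2 * t) - 2 * f (x + t) + f x) <= omega2 f d.
Proof.
  intros HB Ht Hx.
  assert (Hdiff : forall t u, 0 < t -> 0 <= u ->
    Rabs (f (u + 2 * t) - 2 * f (u + t) + f u) <= 4 * B).
  { intros t' u Ht' Hu.
    assert (H1 := HB (u + 2 * t') ltac:(lra)). assert (H2 := HB (u + t') ltac:(lra)).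
    assert (H3 := HB u Hu).
    apply Rabs_le_between in H1, H2, H3. apply Rabs_le. lra. }
  apply Rle_trans with (norm_CB (fun u => f (u + 2 * t) - 2 * f (u + t) + f u)).
  - apply (norm_CB_bounds (fun u => f (u + 2 * t) - 2 * f (u + t) + f u) (4 * B) x); auto.
    intros u Hu. apply Hdiff; lra.
  - apply (real_Lub_ub _ (4 * B)).
    + intros u [t' [Ht' ->]].
      apply (norm_CB_bounds (fun u => f (u + 2 * t') - 2 * f (u + t') + f u) (4 * B) 0); [|lra].
      intros v Hv. apply Hdiff; lra.
    + exists t. auto.
Qed.

(** * Smoothing on the half-line *)

Lemma MVT_derive (f df : R -> R) u v :
  (forall t, is_derive f t (df t)) ->
  exists c, Rmin u v <= c <= Rmax u v /\ f v - f u = df c * (v - u).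
Proof.
  intros Hf. apply MVT_gen; auto.
  intros t _. apply continuity_pt_filterlim.
  apply (ex_derive_continuous (V := R_NormedModule)). exists (df t). auto.
Qed.

(** The mean value theorem for [G (t + h) - G t], then for [G1]. *)
Lemma second_difference_MVT (G G1 G2 : R -> R) h :
  (forall t, is_derive G t (G1 t)) -> (forall t, is_derive G1 t (G2 t)) -> 0 < h ->
  exists c, 0 <= c <= 2 * h /\ G (2 * h) - 2 * G h + G 0 = h ^ 2 * G2 c.
Proof.
  intros D1 D2 Hh.
  destruct (MVT_derive (fun t => G (t + h) - G t) (fun t => G1 (t + h) - G1 t) 0 h) as [c [Hc Ec]].
  { intros t. assert (E1 := D1 t). assert (E2 := D1 (t + h)).
    auto_derive; [split; [eexists; apply E2|split; [eexists; apply E1|auto]]|].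
    rewrite (is_derive_unique (fun z : R => G z) _ _ E1), (is_derive_unique (fun z : R => G z) _ _ E2). ring. }
  destruct (MVT_derive G1 G2 c (c + h) D2) as [e [He Ee]].
  rewrite Rmin_left, Rmax_right in Hc by lra. rewrite Rmin_left, Rmax_right in He by lra.
  exists e. split; [lra|].
  rewrite Ee in Ec. rewrite Rplus_0_l in Ec.
  replace (h + h) with (2 * h) in Ec by ring.
  replace (h ^ 2 * G2 e) with (G2 e * (c + h - c) * (h - 0)) by ring. rewrite <- Ec. ring.
Qed.

(** Two applications of the mean value theorem; the constant is twice the sharp one,
    in exchange for an argument without integral remainder. *)
Lemma taylor_half_line (g g1 g2 : R -> R) L x t :
  (forall u, is_derive g u (g1 u)) -> (forall u, is_derive g1 u (g2 u)) ->
  (forall u, 0 <= u -> Rabs (g2 u) <= L) -> 0 <= x -> 0 <= t ->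
  Rabs (g t - g x - g1 x * (t - x)) <= L * (t - x) ^ 2.
Proof.
  intros D1 D2 HL Hx Ht.
  destruct (MVT_derive g g1 x t D1) as [c [Hc Ec]].
  destruct (MVT_derive g1 g2 x c D2) as [e [He Ee]].
  assert (Hm : 0 <= Rmin x t) by now apply Rmin_glb.
  assert (Hm' : 0 <= Rmin x c) by (apply Rmin_glb; lra).
  rewrite Ec. replace (g1 c * (t - x) - g1 x * (t - x)) with ((g1 c - g1 x) * (t - x)) by ring.
  rewrite Ee, !Rabs_mult.
  assert (Hct : Rabs (c - x) <= Rabs (t - x)).
  { revert Hc. unfold Rmin, Rmax. destruct (Rle_dec x t); intros Hc.
    - rewrite !Rabs_pos_eq; lra.
    - rewrite !Rabs_left1; lra. }
  rewrite <- (pow2_abs (t - x)).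
  assert (H2 := HL e ltac:(lra)).
  assert (H3 := Rabs_pos (t - x)). assert (H4 := Rabs_pos (c - x)). assert (H5 := Rabs_pos (g2 e)).
  replace (L * Rabs (t - x) ^ 2) with (L * Rabs (t - x) * Rabs (t - x)) by ring.
  apply Rmult_le_compat_r; auto. now apply Rmult_le_compat.
Qed.

(** Taylor's formula with increment [1] expresses [g1 x] by two values of [g]. *)
Lemma landau_half_line (g g1 g2 : R -> R) S L x :
  (forall u, is_derive g u (g1 u)) -> (forall u, is_derive g1 u (g2 u)) ->
  (forall u, 0 <= u -> Rabs (g u) <= S) ->
  (forall u, 0 <= u -> Rabs (g2 u) <= L) -> 0 <= x ->
  Rabs (g1 x) <= 2 * S + L.
Proof.
  intros D1 D2 HS HL Hx.
  assert (H := taylor_half_line g g1 g2 L x (x + 1) D1 D2 HL Hx ltac:(lra)).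
  assert (H1 := HS x Hx). assert (H2 := HS (x + 1) ltac:(lra)).
  replace (x + 1 - x) with 1 in H by ring.
  apply Rabs_le_between in H, H1, H2. apply Rabs_le. lra.
Qed.

Lemma continuous_primitive (f : R -> R) :
  (forall t : R, continuous f t) -> exists F : R -> R, forall t : R, is_derive F t (f t).
Proof.
  intros Cf. exists (fun u => RInt f 0 u). intros t.
  apply (is_derive_RInt (V := R_NormedModule) f _ 0); auto.
  exists (mkposreal 1 Rlt_0_1). intros u _.
  apply (RInt_correct (V := R_CompleteNormedModule)).
  apply (ex_RInt_continuous (V := R_CompleteNormedModule)). auto.
Qed.

(** The smoothing is the Steklov mean
    [g x = h^(-2) * int_0^h int_0^h (2 f(x+u+v) - f(x+2(u+v))) du dv].
    The defect [f x - g x] averages the second differences of [f] at [x] with step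
    [u + v <= 2 h], and [g''] is an explicit combination of second differences with
    steps [h] and [2 h].  A second primitive [F2] of [f] turns the double integrals
    into second differences of [F2]. *)
Lemma steklov_smoothing (f : R -> R) h W :
  (forall t, continuous f t) -> 0 < h ->
  (forall x t, 0 <= x -> 0 <= t <= 2 * h -> Rabs (f (x + 2 * t) - 2 * f (x + t) + f x) <= W) ->
  exists g g1 g2 : R -> R,
    (forall t, is_derive g t (g1 t)) /\ (forall t, is_derive g1 t (g2 t)) /\
    (forall x, 0 <= x -> Rabs (f x - g x) <= W) /\
    (forall x, 0 <= x -> Rabs (g2 x) <= 9 / 4 * W / h ^ 2).
Proof.
  intros Cf Hh HW.
  destruct (continuous_primitive f Cf) as [F1 D1].
  assert (CF1 : forall t : R, continuous F1 t).
  { intros t. apply (ex_derive_continuous (V := R_NormedModule)). exists (f t). apply D1. }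
  destruct (continuous_primitive F1 CF1) as [F2 D2].
  assert (X1 : forall t, ex_derive F1 t) by (intros t; exists (f t); apply D1).
  assert (X2 : forall t, ex_derive F2 t) by (intros t; exists (F1 t); apply D2).
  assert (V1 : forall t : R, Derive (fun u : R => F1 u) t = f t) by (intros t; exact (is_derive_unique _ _ _ (D1 t))).
  assert (V2 : forall t : R, Derive (fun u : R => F2 u) t = F1 t) by (intros t; exact (is_derive_unique _ _ _ (D2 t))).
  set (T := fun (k : R -> R) (c x : R) =>
    (2 * (k (x + 2 * h) - 2 * k (x + h) + k x)
     - c * (k (x + 2 * (2 * h)) - 2 * k (x + 2 * h) + k x)) / h ^ 2).
  exists (T F2 (1 / 4)), (T F1 (1 / 4)), (T f (1 / 4)).
  assert (Hh2 : 0 < h ^ 2) by nra.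
  split; [|split; [|split]].
  - intros t. unfold T. auto_derive; [repeat split; auto|]. 
    rewrite !V2. field. lra.
  - intros t. unfold T. auto_derive; [repeat split; auto|].
    rewrite !V1. field. lra.
  - intros x Hx.
    (* [h^2 * (f x - g x)] is the second difference at [0] of this function of [s],
       whose second derivative is the second difference of [f] at [x] with step [s]. *)
    destruct (second_difference_MVT
      (fun s => f x * s ^ 2 / 2 - 2 * F2 (x + s) + F2 (x + 2 * s) / 4)
      (fun s => f x * s - 2 * F1 (x + s) + F1 (x + 2 * s) / 2)
      (fun s => f (x + 2 * s) - 2 * f (x + s) + f x) h) as [c [Hc Ec]]; auto.
    + intros s. auto_derive; [repeat split; auto|]. rewrite !V2. field.
    + intros s. auto_derive; [repeat split; auto|]. rewrite !V1. field.
    + replace (f x - T F2 (1 / 4) x) with (f (x + 2 * c) - 2 * f (x + c) + f x); [now apply HW|].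
      apply Rmult_eq_reg_l with (h ^ 2); [|lra]. rewrite <- Ec.
      unfold T. rewrite Rmult_0_r, Rplus_0_r. field. lra.
  - intros x Hx. unfold T.
    assert (H1 := HW x h Hx ltac:(lra)). assert (H2 := HW x (2 * h) Hx ltac:(lra)).
    unfold Rdiv. rewrite Rabs_mult, (Rabs_pos_eq (/ h ^ 2)).
    2:{ apply Rlt_le, Rinv_0_lt_compat. lra. }
    apply Rmult_le_compat_r.
    { apply Rlt_le, Rinv_0_lt_compat. lra. }
    apply Rabs_le_between in H1, H2. apply Rabs_le. lra.
Qed.

(** The smoothing wants continuity on the whole line, while a member of [C_B] is
    unconstrained to the left of [0]. *)
Lemma C_B_continuous_extension f :
  C_B f -> forall t, continuous (fun u => f (Rmax 0 u)) t.
Proof.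
  intros [_ Hu] t. apply filterlim_locally. intros eps.
  destruct (Hu eps) as [d Hd]. exists d. intros u Hut.
  change (Rabs (u - t) < d) in Hut.
  change (Rabs (f (Rmax 0 u) - f (Rmax 0 t)) < eps).
  apply Hd; try apply Rmax_l.
  apply Rle_lt_trans with (2 := Hut).
  unfold Rmax. destruct (Rle_dec 0 u), (Rle_dec 0 t); unfold Rabs; repeat destruct Rcase_abs; lra.
Qed.

Lemma C_B_continuous f t : C_B f -> 0 < t -> continuous f t.
Proof.
  intros Hf Ht. apply continuous_ext_loc with (fun u => f (Rmax 0 u)).
  - exists (mkposreal t Ht). intros u Hu. change (Rabs (u - t) < t) in Hu.
    apply Rabs_def2 in Hu. rewrite Rmax_right; [auto|lra].
  - now apply C_B_continuous_extension.
Qed.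

(** * The estimate *)

Theorem theorem4 :
  forall (mu lam : R) (a : nat -> R) (rho : R),
    0 <= mu -> 0 <= lam ->
    a 0%nat <> 0 ->
    1 < rho ->
    Rbar_le (Finite rho) (CV_radius (A_coef mu a)) ->
    A_fun mu a 1 <> 0 ->
    (forall r : nat, 0 <= a r / A_fun mu a 1) ->
    exists M : R, 0 < M /\
      forall (f : R -> R) (n : nat) (x : R),
        C_B f -> (1 <= n)%nat -> 0 <= x ->
        Rabs (Dstar mu lam a n f x - f x)
        <= 2 * M *
           (Rmin 1 (lambda_n mu lam a n x / 2) * norm_CB f
            + omega2 f (sqrt (lambda_n mu lam a n x / 2))).
Proof.
  intros mu lam a rho Hmu Hlam _ Hrho Hrad HA Ha.
  (* [2 * 21] collects [W] with coefficient 2 + 36 + 4 from the three error terms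
     below; [|f|] needs only the coefficient 4. *)
  exists 21. split; [lra|]. intros f n x Hf Hn Hx.
  assert (O1 := Omega1_pos mu lam a rho Hmu Hlam Hrho Hrad HA Ha n x Hn Hx).
  assert (O2 := Omega2_nonneg mu lam a rho Hmu Hlam Hrho Hrad HA Ha n x Hn Hx).
  assert (Happrox := fun B F G K L C =>
    Dstar_affine_defect mu lam a rho Hmu Hlam Hrho Hrad HA Ha n x Hn Hx f B F G K L C).
  specialize (fun B F G K L => Happrox B F G K L (fun t => C_B_continuous f t Hf)).
  destruct Hf as [[B HB] Hu].
  assert (Hnorm : forall u, 0 <= u -> Rabs (f u) <= norm_CB f).
  { intros u Hu0. now apply (norm_CB_bounds f B u). }
  assert (Hnorm' : forall u, 0 < u -> Rabs (f u) <= norm_CB f).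
  { intros u Hu0. apply Hnorm. lra. }
  set (nf := norm_CB f) in *.
  assert (Hnf : 0 <= nf) by (apply Rle_trans with (2 := Hnorm x Hx); apply Rabs_pos).
  unfold lambda_n.
  set (o1 := Omega1 mu lam a n x) in *. set (o2 := Omega2 mu lam a n x) in *.
  set (d := (o1 + o2 / 2) / 2).
  assert (Hd : 0 < d) by (unfold d; lra).
  assert (Hsd : 0 < sqrt d) by now apply sqrt_lt_R0.
  assert (HW := fun t y Ht Hy => omega2_bound f B (sqrt d) t y HB Ht Hy).
  set (W := omega2 f (sqrt d)) in *.
  assert (HW0 : 0 <= W).
  { apply Rle_trans with (2 := HW (sqrt d) 0 ltac:(lra) ltac:(lra)). apply Rabs_pos. }
  destruct (Rle_dec 1 d) as [Hd1|Hd1].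
  - rewrite Rmin_left by auto.
    assert (H : Rabs (Dstar mu lam a n f x - (f x + 0 * o1)) <= 2 * nf + 0 * o2).
    { apply (Happrox nf); auto. intros t Ht.
      assert (H1 := Hnorm' t Ht). assert (H2 := Hnorm x Hx).
      apply Rabs_le_between in H1, H2. apply Rabs_le. lra. }
    rewrite !Rmult_0_l, !Rplus_0_r in H. lra.
  - rewrite Rmin_right by lra.
    assert (Hsq : sqrt d * sqrt d = d) by (apply sqrt_sqrt; lra).
    destruct (steklov_smoothing (fun u => f (Rmax 0 u)) (sqrt d / 2) W)
      as [g [g1 [g2 [D1 [D2 [Hfg Hg2]]]]]].
    + apply C_B_continuous_extension. split; [exists B|]; auto.
    + lra.
    + intros y t Hy Ht. rewrite !Rmax_right by lra.
      destruct (Req_dec t 0) as [->|Ht0].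
      * replace (_ - _ + _) with 0 by (rewrite Rmult_0_r, Rplus_0_r; ring). now rewrite Rabs_R0.
      * apply HW; lra.
    + assert (Hfg' : forall y, 0 <= y -> Rabs (f y - g y) <= W).
      { intros y Hy. specialize (Hfg y Hy). now rewrite Rmax_right in Hfg. }
      set (L := 9 / 4 * W / (sqrt d / 2) ^ 2) in *.
      assert (HLd : L * d = 9 * W).
      { unfold L. rewrite <- Hsq at 2. field. lra. }
      assert (HL0 : 0 <= L) by nra.
      assert (Hg1 : Rabs (g1 x) <= 2 * (nf + W) + L).
      { apply (landau_half_line g g1 g2); auto. intros y Hy.
        assert (H1 := Hfg' y Hy). assert (H2 := Hnorm y Hy).
        apply Rabs_le_between in H1, H2. apply Rabs_le. lra. }
      assert (H : Rabs (Dstar mu lam a n f x - (f x + g1 x * o1)) <= 2 * W + L * o2).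
      { apply (Happrox nf); auto. intros t Ht.
        assert (H1 := Hfg' t ltac:(lra)). assert (H2 := Hfg' x Hx).
        assert (H3 := taylor_half_line g g1 g2 L x t D1 D2 Hg2 Hx ltac:(lra)).
        apply Rabs_le_between in H1, H2, H3. apply Rabs_le. lra. }
      assert (H1 : Rabs (g1 x * o1) <= (2 * (nf + W) + L) * o1).
      { rewrite Rabs_mult, (Rabs_pos_eq o1) by lra. apply Rmult_le_compat_r; lra. }
      assert (Eo : o1 + o2 / 2 = 2 * d) by (unfold d; field).
      apply Rle_trans with (2 * W + (2 * (nf + W) + L) * o1 + L * o2).
      { apply Rabs_le_between in H, H1. apply Rabs_le. lra. }
      assert (H2 : o1 * nf <= 2 * d * nf) by (apply Rmult_le_compat_r; lra).
      assert (H3 : o1 * W <= 2 * W) by (apply Rmult_le_compat_r; lra).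
      assert (H4 : L * (o1 + o2) <= L * (4 * d)) by (apply Rmult_le_compat_l; lra).
      assert (0 <= d * nf) by (apply Rmult_le_pos; lra).
      lra.
Qed.
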